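(* Let $K$ be a field, $R=K[x_1,\dots,x_n]$, and let $I\subset R$ be a matroidal ideal of degree $3$ which is full-supported and satisfies $\gcd(I)=1$. Then $\operatorname{astab}(I)=\operatorname{dstab}(I)$.
   Context: For a monomial ideal $I$ of $R=K[x_1,\dots,x_n]$, $G(I)$ denotes its unique minimal set of monomial generators. $I$ is full-supported if every variable $x_1,\dots,x_n$ divides some element of $G(I)$; $\gcd(I)$ is the greatest common divisor of the elements of $G(I)$. A monomial ideal $I$ is polymatroidal of degree $d$ if it is generated by monomials of the single degree $d$ and for any $u,v\in G(I)$ and any $i$ with $\deg_{x_i}(u)>\deg_{x_i}(v)$ there is $j$ with $\deg_{x_j}(u)<\deg_{x_j}(v)$ and $x_j(u/x_i)\in I$. It is matroidal if moreover it is generated by square-free monomials. $\operatorname{Ass}(J)$ denotes the set of associated primes of $R/J$. By Brodmann, $\operatorname{Ass}(I^t)$ and $\operatorname{depth} R/I^t$ are constant for large $t$. $\operatorname{astab}(I)$ is the smallest integer $t_0\ge 1$ with $\operatorname{Ass}(I^t)=\operatorname{Ass}(I^{t_0})$ for all $t\ge t_0$, and $\operatorname{dstab}(I)$ is the smallest integer $t_0\ge 1$ with $\operatorname{depth} R/I^t=\operatorname{depth} R/I^{t_0}$ for all $t\ge t_0$. *)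

(* Defs.v *)
From HB Require Import structures.
From mathcomp Require Import all_boot all_algebra.
From mathcomp Require Export mpoly.

Set Implicit Arguments.
Unset Strict Implicit.
Unset Printing Implicit Defensive.

Import GRing.Theory.
Local Open Scope ring_scope.

(* Ideals are [Prop]-valued predicates, so that no decision procedure for
   membership is required; the boolean [idealr_closed] predicates of
   [ring_quotient] are moreover always proper. *)
Section Ideals.

Variable R : comNzRingType.
Implicit Types (I J P S : R -> Prop) (s : seq R).

Definition is_ideal I : Prop :=
  [/\ I 0, forall f g, I f -> I g -> I (f + g) & forall a f, I f -> I (a * f)].

Definition prime_ideal P : Prop :=
  [/\ is_ideal P, ~ P 1 & forall f g, P (f * g) -> P f \/ P g].

Definition gen_ideal S : R -> Prop := fun f =>
  exists (k : nat) (a g : 'I_k -> R),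
    (forall i, S (g i)) /\ f = \sum_(i < k) a i * g i.

Definition mul_ideal I J : R -> Prop :=
  gen_ideal (fun h => exists f g, [/\ I f, J g & h = f * g]).

Fixpoint pow_ideal I (t : nat) : R -> Prop :=
  if t is t'.+1 then mul_ideal I (pow_ideal I t') else fun=> True.

Definition colon_ideal J (f : R) : R -> Prop := fun g => J (g * f).

(* [colon_ideal J f] is the annihilator of the class of [f] in [R / J]. *)
Definition Ass J P : Prop :=
  prime_ideal P /\ exists f, forall g, P g <-> colon_ideal J f g.

Definition add_seq J s : R -> Prop := gen_ideal (fun g => J g \/ g \in s).

(* [s] is a regular sequence on the module [R / J]. *)
Definition regular_seq J s : Prop :=
  (forall i, (i < size s)%N -> forall g,
     add_seq J (take i s) (s`_i * g) -> add_seq J (take i s) g)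
  /\ ~ add_seq J s 1.

End Ideals.

Section MonomialIdeals.

Variables (K : fieldType) (n : nat).
Local Notation R := {mpoly K[n]}.
Implicit Types (I J : R -> Prop) (G : 'X_{1..n} -> Prop).

Definition mon_ideal G : R -> Prop :=
  gen_ideal (fun f => exists2 u, G u & f = 'X_[u]).

Definition generates G I : Prop := forall f, I f <-> mon_ideal G f.

Definition minimal_generating_set G I : Prop :=
  generates G I /\
  forall G', (forall u, G' u -> G u) -> generates G' I -> forall u, G u -> G' u.

(* The set G(I): a monomial ideal has exactly one minimal set of monomial
   generators, so the existential quantifier selects that set. *)
Definition mingens I : 'X_{1..n} -> Prop := fun u =>
  exists2 G, minimal_generating_set G I & G u.

Definition full_supported I : Prop :=
  forall i : 'I_n, exists2 u, mingens I u & (0 < u i)%N.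

(* [(u <= v)%MM] is the divisibility order on monomials. *)
Definition is_gcd (w : 'X_{1..n}) G : Prop :=
  (forall u, G u -> (w <= u)%MM) /\
  forall w', (forall u, G u -> (w' <= u)%MM) -> (w' <= w)%MM.

Definition polymatroidal I (d : nat) : Prop :=
  (exists2 G, generates G I & forall u, G u -> mdeg u = d) /\
  forall u v, mingens I u -> mingens I v ->
  forall i : 'I_n, (v i < u i)%N ->
  exists2 j : 'I_n, (u j < v j)%N & I 'X_[(u - U_(i) + U_(j))%MM].

Definition matroidal I (d : nat) : Prop :=
  polymatroidal I d /\
  exists2 G, generates G I & forall u, G u -> forall i : 'I_n, (u i <= 1)%N.

Definition irrelevant_ideal : R -> Prop :=
  gen_ideal (fun f => exists i : 'I_n, f = 'X_i).

(* depth R / J = d, with respect to the graded maximal ideal. *)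
Definition is_depth J (d : nat) : Prop :=
  (exists s : seq R, [/\ size s = d, forall f, f \in s -> irrelevant_ideal f
                       & regular_seq J s]) /\
  forall s : seq R, (forall f, f \in s -> irrelevant_ideal f) ->
    regular_seq J s -> (size s <= d)%N.

Definition least_stable (same : nat -> nat -> Prop) (t0 : nat) : Prop :=
  let stable s := (1 <= s)%N /\ forall t, (s <= t)%N -> same t s in
  stable t0 /\ forall s, stable s -> (t0 <= s)%N.

Definition is_astab I : nat -> Prop :=
  least_stable (fun t s =>
    forall P, Ass (pow_ideal I t) P <-> Ass (pow_ideal I s) P).

Definition is_dstab I : nat -> Prop :=
  least_stable (fun t s =>
    exists2 d, is_depth (pow_ideal I t) d & is_depth (pow_ideal I s) d).

End MonomialIdeals.

(* Main.v *)
Require Import Defs.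
From mathcomp Require Import all_boot all_algebra.
From mathcomp Require Import zify ring.
From Stdlib Require Import Classical ClassicalEpsilon.
From Stdlib Require Import FunctionalExtensionality PropExtensionality.

Set Implicit Arguments.
Unset Strict Implicit.
Unset Printing Implicit Defensive.

Import GRing.Theory.

(* The square-free generators of [I] are the bases of a matroid of rank 3
   without loops (full support) and without coloops (trivial gcd). A monomial [x^a] lies in
   [I^t] iff [a(E \ F) >= t (3 - rk F)] for every flat [F]; so [I^t] is an intersection of
   powers of the monomial primes [P_(E \ F)], and [Ass(I^t)] consists of
   - all [P_(E \ L)] with [L] a line,
   - for [t >= 2], the [P_(E \ p)] with [p] a point on at least three lines,
   - the maximal ideal, iff some monomial [x^u] represents a socle element of [R / I^t].
   If four points are in general position, a socle element exists for large [t]; with [s]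
   the least such [t], [s >= 2], the depth of [R / I^t] is [0] iff [t >= s], and both
   stability indices are [s]. Otherwise the simplified matroid is a line plus a point [q] off
   it, and the maximal ideal is never associated. If the line has at least three points, then
   [P_(E \ q)] appears at [t = 2], and depth is [1] for [t >= 2] but at least [2] for [t = 1]:
   both indices are [2]. If it has two points, [Ass(I^t)] and depth [2] are constant.
   Upper bounds for depth come from the vanishing of low Koszul cohomology on the variables
   and Mayer-Vietoris for [I^t = J n N]; lower bounds from explicit linear forms. *)

(** * Weights of monomials *)

(** That the flat inequalities describe [I^t] is an integer decomposition property: a monomial
    satisfying them for [t] must give up one basis at a time. In rank 3 this is settled by counting
    weights on points and lines. The field is arbitrary, possibly finite, so generic linear forms
    may not exist; [\sum_i 'X_i], being monic in every variable, replaces them. Depth is defined by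
    regular sequences, so its upper bounds come from explicit cocycle equations in degrees at most
    2. Four points in general position always give a socle element at [t = 3], hence [s] is 2 or 3
    in that case. *)

Section Weights.

Variable n : nat.
Implicit Types (A B : pred 'I_n) (m : 'X_{1..n}).

Definition wt A m : nat := \sum_(i | A i) m i.

Lemma wtD A m1 m2 : wt A (m1 + m2)%MM = wt A m1 + wt A m2.
Proof. by rewrite /wt -big_split; apply: eq_bigr => i _; rewrite mnmDE. Qed.

Lemma wtU A i : wt A U_(i)%MM = A i.
Proof.
rewrite /wt; case Ai: (A i).
  rewrite (bigD1 i) //= big1 ?mnm1E ?eqxx // => j /andP[_ /negPf ji].
  by rewrite mnm1E eq_sym ji.
by rewrite big1 // => j Aj; rewrite mnm1E; case: eqP => // ij; rewrite ij Aj in Ai.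
Qed.

Lemma wtMn A m k : wt A (m *+ k)%MM = k * wt A m.
Proof. by rewrite /wt big_distrr; apply: eq_bigr => i _; rewrite mulmnE mulnC. Qed.

Lemma wtT m : wt predT m = mdeg m.
Proof. by rewrite mdegE. Qed.

Lemma wt_ext A B m : A =1 B -> wt A m = wt B m.
Proof. by move=> AB; apply: eq_bigl. Qed.

(** After exchanging sums, each [m i] is weighted by the number of predicates containing [i].
    Inequalities between weights of flats thus become Boolean checks on the support of [m]. *)
Lemma wt_leq (s r : seq (pred 'I_n)) m :
  (forall i, 0 < m i -> \sum_(A <- s) (A i : nat) <= \sum_(B <- r) (B i : nat)) ->
  \sum_(A <- s) wt A m <= \sum_(B <- r) wt B m.
Proof.
have wtE q : \sum_(A <- q) wt A m = \sum_i (\sum_(A <- q) (A i : nat)) * m i.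
  elim: q => [|A q IHq]; first by rewrite big_nil big1 // => i _; rewrite big_nil.
  rewrite big_cons IHq /wt big_mkcond -big_split; apply: eq_bigr => i _.
  by rewrite big_cons mulnDl; case: (A i); rewrite ?mul1n.
move=> le_sr; rewrite !wtE; apply: leq_sum => i _.
by case: (posnP (m i)) => [->|/le_sr]; rewrite ?muln0 // leq_mul2r => ->; rewrite orbT.
Qed.

Lemma wt_sub A B m : (forall i, A i -> B i) -> wt A m <= wt B m.
Proof.
move=> AB; have := @wt_leq [:: A] [:: B] m; rewrite !big_cons !big_nil !addn0.
by apply=> i _; rewrite !big_cons !big_nil !addn0; case: (A i) (AB i) => // ->.
Qed.

Lemma wt_ge A m i : A i -> m i <= wt A m.
Proof. by move=> Ai; rewrite /wt (bigD1 i) //= leq_addr. Qed.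

Lemma wt_gt0 A m : 0 < wt A m -> exists2 i, A i & 0 < m i.
Proof.
rewrite lt0n sum_nat_eq0 negb_forall => /existsP[i].
by rewrite negb_imply -lt0n => /andP[Ai mi]; exists i.
Qed.

End Weights.

Section MoreWeights.

Variable n : nat.
Implicit Types (A B D : pred 'I_n) (m : 'X_{1..n}).

Lemma wt_cover A B D m : (forall i, 0 < m i -> D i -> A i || B i) ->
  wt D m <= wt A m + wt B m.
Proof.
move=> DAB; have := @wt_leq n [:: D] [:: A; B] m.
rewrite !big_cons !big_nil !addn0; apply=> i /DAB; rewrite !big_cons !big_nil.
by case: (D i) (A i) (B i) => [] [] [] //= /(_ isT).
Qed.

Lemma wt_disj A B D m : (forall i, A i -> D i) -> (forall i, B i -> D i) ->
  (forall i, A i -> ~~ B i) -> wt A m + wt B m <= wt D m.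
Proof.
move=> AD BD AB; have := @wt_leq n [:: A; B] [:: D] m.
rewrite !big_cons !big_nil !addn0; apply=> i _; move: (AD i) (BD i) (AB i).
rewrite !big_cons !big_nil; case: (D i) (A i) (B i) => [] [] [] //= a b c.
- by have := c isT.
- by have := a isT.
- by have := a isT.
- by have := b isT.
Qed.

Lemma wtUI A B m : wt A m + wt B m <= wt (predU A B) m + wt (predI A B) m.
Proof.
have := @wt_leq n [:: A; B] [:: predU A B : pred _; predI A B : pred _] m.
rewrite !big_cons !big_nil !addn0; apply=> i _.
by rewrite !big_cons !big_nil /=; case: (A i) (B i) => [] [].
Qed.

Lemma wtC A m : wt A m + wt (predC A) m = mdeg m.
Proof. by rewrite -wtT /wt [RHS](bigID A). Qed.

Lemma wt_le_mdeg A m : wt A m <= mdeg m.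
Proof. by rewrite -(wtC A) leq_addr. Qed.

Lemma mnm_decr m i : 0 < m i -> exists m', m = (m' + U_(i))%MM.
Proof.
move=> mi; exists (m - U_(i))%MM; rewrite submK //.
by apply/mnm_lepP => j; rewrite mnm1E; case: eqP => [<-|].
Qed.

End MoreWeights.

(** * Matroids of rank 3 *)

(* [bs x y z] says that [x], [y], [z] form a basis. *)
Record rank3_matroid (n : nat) (bs : 'I_n -> 'I_n -> 'I_n -> bool) : Prop :=
  Rank3Matroid {
    bsC12 : forall x y z, bs x y z = bs y x z;
    bsC23 : forall x y z, bs x y z = bs x z y;
    bsxx : forall x z, bs x x z = false;
    bs_exch : forall x y z u v w, bs x y z -> bs u v w ->
      [\/ bs u y z, bs v y z | bs w y z];
    bs_loopless : forall x, exists y z, bs x y z;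
    bs_coloopless : forall x, exists u v w, [/\ bs u v w, u != x, v != x & w != x] }.

Section Matroid.

Variables (n : nat) (bs : 'I_n -> 'I_n -> 'I_n -> bool).
Hypothesis M : rank3_matroid bs.
Implicit Types (x y z u v w p q : 'I_n) (m : 'X_{1..n}).

Definition par x y : bool := [forall z, ~~ bs x y z].
Definition npar x y : bool := ~~ par x y.
(** For [npar x y] this is the line spanned by [x] and [y]. Its complement is [bs x y], and the
    complement of the point [par x] is [npar x]; these complements carry the inequalities below. *)
Definition lin x y z : bool := ~~ bs x y z.

Lemma nparP x y : reflect (exists z, bs x y z) (npar x y).
Proof.
by rewrite /npar /par negb_forall; apply: (iffP existsP) => -[z];
  [move/negPn; exists z | exists z; apply/negPn].
Qed.

Let C12 := bsC12 M.
Let C23 := bsC23 M.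
Let rot x y z : bs x y z = bs y z x. Proof. by rewrite C12 C23. Qed.
Let rot2 x y z : bs x y z = bs z x y. Proof. by rewrite C23 C12. Qed.
Let C13 x y z : bs x y z = bs z y x. Proof. by rewrite rot C12. Qed.

Ltac perm := try unfold lin; solve
  [ assumption | rewrite C12; assumption | rewrite C23; assumption
  | rewrite C13; assumption | rewrite rot; assumption | rewrite rot2; assumption ].

Lemma linxyx x y : lin x y x. Proof. by rewrite /lin C23 (bsxx M). Qed.
Lemma linxyy x y : lin x y y. Proof. by rewrite /lin C13 (bsxx M). Qed.

Lemma bs_npar x y z : bs x y z -> [/\ npar x y, npar x z & npar y z].
Proof.
by move=> b; split; apply/nparP; [exists z | exists y | exists x]; perm.
Qed.

(** Complete [x], [y] to a basis by [p]. Exchanging [p] against a basis [u], [v], [w] would put one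
    of these three off the line. *)
Lemma npar_lin x y u v w : npar x y -> lin x y u -> lin x y v -> lin x y w -> lin u v w.
Proof.
move=> /nparP[p b] lu lv lw; apply/negP => buvw.
have b' : bs p x y by perm.
by case: (bs_exch M b' buvw) => b2; [move: lu|move: lv|move: lw]; apply/negP/negPn; perm.
Qed.

Lemma par_refl x : par x x.
Proof. by apply/forallP => z; rewrite (bsxx M). Qed.

Lemma par_sym x y : par x y = par y x.
Proof. by apply: eq_forallb => z; rewrite C12. Qed.

Lemma npar_sym x y : npar x y = npar y x.
Proof. by rewrite /npar par_sym. Qed.

(** If [bs a' y z] failed, then [a], [y], [z] would lie on one line through [a']: the one through
    [y], or, when [y] is parallel to [a'], the one through [p] or [z]. *)
Lemma par_bs x x' y z : par x x' -> bs x y z = bs x' y z.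
Proof.
suff sub a a' : par a a' -> bs a y z -> bs a' y z.
  by move=> pxx'; apply/idP/idP; apply: sub; rewrite // par_sym.
move=> paa' b; have [p [q bpq]] := bs_loopless M a'.
have La w : lin a' w a by move/forallP/(_ w): paa' => l; perm.
apply: contraT => l.
have [pa'y|npa'y] := boolP (par a' y); last first.
  by case/negP: (npar_lin npa'y (La y) (linxyy _ _) l).
have Ly w : lin a' w y by move/forallP/(_ w): pa'y => l'; perm.
have [np _ _] := bs_npar bpq.
have [bpz|lpz] := boolP (bs a' p z); last by case/negP: (npar_lin np (La p) (Ly p) lpz).
have [_ nz _] := bs_npar bpz.
by case/negP: (npar_lin nz (La z) (Ly z) (linxyy _ _)).
Qed.

Lemma par_trans x y z : par x y -> par y z -> par x z.
Proof. by move=> pxy /forallP pyz; apply/forallP => w; rewrite (par_bs _ _ pxy). Qed.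

Lemma par_par x y z : par x y -> par x z = par y z.
Proof.
move=> pxy; apply/idP/idP; last exact: par_trans.
by apply: par_trans; rewrite par_sym.
Qed.

Lemma par_lin3 x y z z' : par z z' -> lin x y z = lin x y z'.
Proof. by move=> p; rewrite /lin rot2 (par_bs _ _ p) -rot2. Qed.

Lemma lin_eq x y u v z : npar x y -> npar u v -> lin x y u -> lin x y v ->
  lin u v z = lin x y z.
Proof.
move=> nxy nuv lu lv; apply/idP/idP => l; last exact: npar_lin lu lv l.
case/nparP: nuv => p b; apply: contraT => b2; have b3 : bs p u v by perm.
have {}b2 : bs x y z by apply/negPn.
have luvx : lin u v x by apply: npar_lin lu lv (linxyx _ _).
have luvy : lin u v y by apply: npar_lin lu lv (linxyy _ _).
by case/negP: (npar_lin (introT (nparP u v) (ex_intro _ p b)) luvx luvy l).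
Qed.

Lemma lin_inter x y u v z w : npar x y -> npar u v -> npar z w ->
  lin x y z -> lin x y w -> lin u v z -> lin u v w -> lin x y =1 lin u v.
Proof.
by move=> nxy nuv nzw xz xw uz uw i; rewrite -(lin_eq i nxy nzw) // (lin_eq i nuv).
Qed.

(* The monomials of [I^t]: one inequality [wt (~ F) m >= t (3 - rk F)] for each flat [F],
   namely the empty flat, the parallel classes and the lines. *)
Definition cond t m : bool :=
  [&& 3 * t <= mdeg m, [forall x, 2 * t <= wt (npar x) m] &
      [forall x, forall y, npar x y ==> (t <= wt (bs x y) m)]].

Lemma condP t m : reflect
  [/\ 3 * t <= mdeg m, forall x, 2 * t <= wt (npar x) m &
      forall x y, npar x y -> t <= wt (bs x y) m] (cond t m).
Proof.
apply: (iffP and3P) => -[h1 h2 h3]; split=> //.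
- by move=> x; move/forallP: h2; apply.
- by move=> x y; move/forallP/(_ x)/forallP/(_ y)/implyP: h3.
- exact/forallP.
- by apply/forallP => x; apply/forallP => y; apply/implyP/h3.
Qed.

Lemma wt_par x m : wt (par x) m + wt (npar x) m = mdeg m.
Proof. exact: wtC. Qed.

Lemma wt_lin x y m : wt (lin x y) m + wt (bs x y) m = mdeg m.
Proof. by rewrite addnC -(wtC (bs x y)). Qed.

(** In the minimal degree, lower bounds on complements turn into the rank inequalities of the base
    polytope: a flat weighs at most [t] times its rank. *)
Lemma condP_exact t m : mdeg m = 3 * t ->
  reflect ((forall x, wt (par x) m <= t) /\
           (forall x y, npar x y -> wt (lin x y) m <= 2 * t)) (cond t m).
Proof.
move=> dm; apply: (iffP (condP _ _)) => [[_ h2 h3]|[h2 h3]]; split.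
- by move=> x; have := wt_par x m; have := h2 x; lia.
- by move=> x y nxy; have := wt_lin x y m; have := h3 x y nxy; lia.
- by lia.
- by move=> x; have := wt_par x m; have := h2 x; lia.
- by move=> x y nxy; have := wt_lin x y m; have := h3 x y nxy; lia.
Qed.

Lemma npar_bs p x y i : par p i -> bs x y i -> bs x y p.
Proof. by move=> ppi; have := par_lin3 x y ppi; rewrite /lin => /negb_inj ->. Qed.

(* The variable to be dropped lies in all flats whose inequality is tight. *)
Lemma cond_reduce t m : cond t m -> 3 * t < mdeg m ->
  exists i m', m = (m' + U_(i))%MM /\ cond t m'.
Proof.
move=> /condP[h1 h2 h3] lt_m.
suff [i mi [hp hl]] : exists2 i, 0 < m i &
    (forall x, npar x i -> 2 * t < wt (npar x) m) /\
    (forall x y, npar x y -> bs x y i -> t < wt (bs x y) m).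
  have [m' def_m] := mnm_decr mi; exists i, m'; split=> //.
  apply/condP; split=> [|x|x y nxy].
  - by move: lt_m; rewrite def_m mdegD mdeg1; lia.
  - move: (h2 x) (hp x); rewrite def_m wtD wtU; case: (npar x i) => /=; last by lia.
    by move=> _ /(_ isT); lia.
  - move: (h3 x y nxy) (hl x y nxy); rewrite def_m wtD wtU; case: (bs x y i) => /=.
      by move=> _ /(_ isT); lia.
    by lia.
have [/existsP[p tp]|/existsPn no_p] := boolP [exists p, wt (npar p) m <= 2 * t].
  have := wt_par p m => wp; have [i ppi mi] : exists2 i, par p i & 0 < m i.
    by apply: wt_gt0; lia.
  (* As [mdeg m > 3 * t], the tight point weighs more than [t], and this excess makes the inequality
     of every flat avoiding it strict. *)
  exists i => //; split=> [x nxi|x y nxy b].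
    have nxp : npar x p by move: nxi; rewrite npar_sym /npar -(par_par _ ppi) -/(npar _ _) npar_sym.
    suff : wt (par p) m + wt (bs x p) m <= wt (npar x) m by have := h3 _ _ nxp; lia.
    apply: wt_disj => j.
    + by move=> ppj; rewrite npar_sym /npar -(par_par _ ppj) -/(npar _ _) npar_sym.
    + by case/bs_npar.
    + by move=> ppj; rewrite -[~~ _]/(lin _ _ _) -(par_lin3 _ _ ppj) linxyy.
  apply: leq_trans (wt_sub (A := par p) m _); first by lia.
  move=> j ppj; apply: npar_bs (npar_bs ppi b); by rewrite par_sym.
have [/existsP[x /existsP[y /andP[nxy txy]]]|no_l] :=
    boolP [exists x, exists y, npar x y && (wt (bs x y) m <= t)].
  have := wt_lin x y m => wl; have [i li mi] : exists2 i, lin x y i & 0 < m i.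
    by apply: wt_gt0; lia.
  exists i => //; split=> [u _|u v nuv b]; first by have := no_p u; lia.
  (* Two distinct tight lines would meet in a point [z], because their weights add up to more than
     [mdeg m]. The complement of [z] is covered by the two complements, so it weighs at most
     [2 * t], against [no_p]. *)
  rewrite ltnNge; apply/negP => tuv.
  have := wtUI (lin x y) (lin u v) m; have := wt_le_mdeg (predU (lin x y) (lin u v)) m.
  have := wt_lin u v m => wuv wU wI.
  have [z /andP[zx zu] _] : exists2 z, predI (lin x y) (lin u v) z & 0 < m z.
    by apply: wt_gt0; lia.
  suff : wt (npar z) m <= wt (bs x y) m + wt (bs u v) m by have := no_p z; lia.
  apply: wt_cover => j _ nzj; apply: contraLR b; rewrite negb_or => /andP[xj uj].
  by rewrite -[~~ bs u v i]/(lin u v i) -(lin_inter nxy nuv nzj zx xj zu uj).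
have [i _ mi] : exists2 i, predT i & 0 < m i by apply: wt_gt0; rewrite wtT; lia.
exists i => //; split=> [x _|x y nxy _]; first by have := no_p x; lia.
by move/existsPn/(_ x)/existsPn/(_ y): no_l; rewrite nxy ltnNge.
Qed.

Lemma basis_decr x y z m : bs x y z -> 0 < m x -> 0 < m y -> 0 < m z ->
  exists m', m = (m' + (U_(x) + U_(y) + U_(z)))%MM.
Proof.
move=> b mx my mz; exists (m - (U_(x) + U_(y) + U_(z)))%MM; rewrite submK //.
have nxy : x != y by apply: contraL b => /eqP ->; rewrite (bsxx M).
have nxz : x != z by apply: contraL b => /eqP ->; apply: linxyx.
have nyz : y != z by apply: contraL b => /eqP ->; apply: linxyy.
apply/mnm_lepP => j; rewrite !mnmDE !mnm1E.
have [jx|_] := eqVneq x j; have [jy|_] := eqVneq y j; have [jz|_] := eqVneq z j;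
  subst=> //; move: nxy nxz nyz; by rewrite ?eqxx // => *; lia.
Qed.

(** Distinct lines share at most one parallel class. *)
Lemma lin_inter_wt x y u v m t i : npar x y -> npar u v -> lin x y i != lin u v i ->
  (forall w, wt (par w) m <= t) -> wt (predI (lin x y) (lin u v)) m <= t.
Proof.
move=> nxy nuv ni le_t; have [->//|] := posnP (wt (predI (lin x y) (lin u v)) m).
case/wt_gt0 => z /andP[xz uz] _; apply: leq_trans (le_t z); apply: wt_sub => j /andP[xj uj].
apply: contraNT ni => nzj; apply/eqP; exact: lin_inter nxy nuv nzj xz xj uz uj i.
Qed.

Lemma lin_through x p q : npar p q -> lin p q x -> exists2 u, npar x u & lin p q =1 lin x u.
Proof.
move=> npq lx; have [pxp|nxp] := boolP (par x p); last first.
  by exists p => // i; rewrite (lin_eq i npq nxp) // linxyx.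
have nxq : npar x q by rewrite /npar (par_par _ pxp).
by exists q => // i; rewrite (lin_eq i npq nxq) // linxyy.
Qed.

(* When [m] has the minimal degree, the basis must contain an element of every
   tight point, two of every tight line and one of every line of weight [2t+1]. *)
Lemma cond_split_exact t m : cond t.+1 m -> mdeg m = 3 * t.+1 ->
  exists x y z m', [/\ bs x y z, m = (m' + (U_(x) + U_(y) + U_(z)))%MM & cond t m'].
Proof.
move=> cm dm; have [hp hl] := condP_exact dm cm.
suff [x [y [z [b [mx my mz] H]]]] : exists x y z, [/\ bs x y z,
    [/\ 0 < m x, 0 < m y & 0 < m z] &
    forall m', m = (m' + (U_(x) + U_(y) + U_(z)))%MM -> mdeg m' = 3 * t ->
      (forall p, wt (par p) m' <= t) /\ (forall p q, npar p q -> wt (lin p q) m' <= 2 * t)].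
  have [m' def_m] := basis_decr b mx my mz.
  have dm' : mdeg m' = 3 * t by move: dm; rewrite def_m !mdegD !mdeg1; lia.
  by exists x, y, z, m'; split=> //; apply/(condP_exact dm')/H.
have [/existsP[p tp]|/existsPn no_p] := boolP [exists p, t < wt (par p) m].
  have [x px mx] : exists2 x, par p x & 0 < m x by apply: wt_gt0; lia.
  have wx : wt (par x) m = t.+1.
    by rewrite -(wt_ext m (fun i => par_par i px)); have := hp p; lia.
  have wnx := wt_par x m.
  (* Once [par x] weighs exactly [t] in [m'], a line missing [x] has at most the remaining [2 * t],
     and another point is bounded through its line with [x]. Only the lines through [x] remain. *)
  suff [y [z [b my mz H]]] : exists y z, [/\ bs x y z, 0 < m y, 0 < m z &
      forall m', m = (m' + (U_(x) + U_(y) + U_(z)))%MM -> wt (par x) m' = t ->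
        forall u, npar x u -> wt (lin x u) m' <= 2 * t].
    exists x, y, z; split=> // m' def_m dm'.
    have [nxy nxz _] := bs_npar b.
    have wx' : wt (par x) m' = t.
      by move: wx; rewrite def_m !wtD !wtU par_refl (negPf nxy) (negPf nxz); lia.
    have {}H p' q : npar p' q -> wt (lin p' q) m' <= 2 * t.
      move=> npq; have [lx|nlx] := boolP (lin p' q x).
        have [u nxu /wt_ext ->] := lin_through npq lx; exact: H def_m wx' u nxu.
      suff : wt (lin p' q) m' + wt (par x) m' <= mdeg m' by lia.
      rewrite -[mdeg m']wtT; apply: wt_disj => // j lj; apply: contra nlx => pxj.
      by rewrite (par_lin3 _ _ pxj).
    split=> // q; have [pqx|nqx] := boolP (par q x).
      by rewrite (wt_ext _ (fun i => par_par i pqx)) wx'.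
    suff : wt (par q) m' + wt (par x) m' <= wt (lin q x) m' by have := H _ _ nqx; lia.
    apply: wt_disj => j.
    + by move=> pqj; rewrite -(par_lin3 _ _ pqj) linxyx.
    + by move=> pxj; rewrite -(par_lin3 _ _ pxj) linxyy.
    + by move=> pqj; rewrite par_sym -(par_par _ pqj).
  have [/existsP[u0 /andP[nxu0 tu0]]|/existsPn no_u] :=
      boolP [exists u, npar x u && (2 * t + 1 < wt (lin x u) m)].
    have [y /andP[ly nxy] my] : exists2 y, predI (lin x u0) (npar x) y & 0 < m y.
      apply: wt_gt0; suff : wt (lin x u0) m <= wt (par x) m + wt (predI (lin x u0) (npar x)) m.
        by lia.
      by apply: wt_cover => j _ /= ->; rewrite /npar; case: (par x j).
    have lxy i : lin x y i = lin x u0 i by apply: lin_eq => //; apply: linxyx.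
    move: tu0; rewrite -(wt_ext m lxy) => tu0; have w2 := wt_lin x y m; have h2 := hl _ _ nxy.
    have [z b mz] : exists2 z, bs x y z & 0 < m z by apply: wt_gt0; lia.
    exists y, z; split=> // m' def_m wx' u nxu.
    have [ly'|nly'] := boolP (lin x u y).
      have := hl _ _ nxu; rewrite {1}def_m !wtD !wtU linxyx ly' /=; clear; lia.
    have [lz'|nlz'] := boolP (lin x u z).
      have := hl _ _ nxu; rewrite {1}def_m !wtD !wtU linxyx lz' /=; clear; lia.
    (* The line [lin x y] weighs [2 * t + 2] in [m], which leaves [t + 1] off it, and [t] once [z]
       is removed; other lines through [x] meet it only in [par x]. *)
    suff : wt (lin x u) m' <= wt (par x) m' + wt (bs x y) m'.
      move: w2 wx' tu0; rewrite {2}def_m dm !wtD !wtU b; clear; lia.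
    apply: wt_cover => j _ lj; apply: contraNT nly'; rewrite negb_or => /andP[nxj lj'].
    by rewrite (lin_inter nxu nxy nxj) ?linxyx ?linxyy.
  have [y nxy my] : exists2 y, npar x y & 0 < m y by apply: wt_gt0; lia.
  have w2 := wt_lin x y m; have h2 := hl _ _ nxy.
  have [z b mz] : exists2 z, bs x y z & 0 < m z by apply: wt_gt0; lia.
  exists y, z; split=> // m' def_m wx' u nxu.
  have := no_u u; rewrite nxu -leqNgt /= {1}def_m !wtD !wtU linxyx; clear; lia.
have {}hp p : wt (par p) m <= t by rewrite leqNgt.
suff [x [y [z [b [mx my mz] H]]]] : exists x y z, [/\ bs x y z,
    [/\ 0 < m x, 0 < m y & 0 < m z] &
    forall m', m = (m' + (U_(x) + U_(y) + U_(z)))%MM ->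
      (forall p, wt (par p) m' <= t) -> (forall p q, npar p q -> wt (lin p q) m' <= 2 * t)].
  exists x, y, z; split=> // m' def_m dm'.
  have hp' p : wt (par p) m' <= t.
    by apply: leq_trans (hp p); rewrite def_m wtD leq_addr.
  by split=> //; apply: H.
have on_line u v x : npar u v -> lin u v x -> t < wt (lin u v) m ->
    exists y, [/\ npar x y, 0 < m y & lin x y =1 lin u v].
  move=> nuv lx w1; have [y /andP[ly nxy] my] : exists2 y, predI (lin u v) (npar x) y & 0 < m y.
    apply: wt_gt0; suff : wt (lin u v) m <= wt (par x) m + wt (predI (lin u v) (npar x)) m.
      by have := hp x; lia.
    by apply: wt_cover => j _ /= ->; rewrite /npar; case: (par x j).
  by exists y; split=> // i; apply: lin_eq.
have [/existsP[u /existsP[v /andP[nuv tuv]]]|no_l] :=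
    boolP [exists u, exists v, npar u v && (2 * t + 1 < wt (lin u v) m)].
  have [x lx mx] : exists2 x, lin u v x & 0 < m x by apply: wt_gt0; lia.
  have [|y [nxy my lxy]] := on_line u v x nuv lx; first by lia.
  have w2 := wt_lin x y m; have h2 := hl _ _ nxy.
  have [z b mz] : exists2 z, bs x y z & 0 < m z by apply: wt_gt0; lia.
  exists x, y, z; split=> // m' def_m hp' p q npq.
  have [/andP[lx' ly']|nl] := boolP (lin p q x && lin p q y).
    have := hl _ _ npq; rewrite {1}def_m !wtD !wtU lx' ly'; clear; lia.
  have [i ni] : exists i, lin p q i != lin x y i.
    case/nandP: nl => nl; [exists x|exists y].
      by rewrite (negPf nl) linxyx.
    by rewrite (negPf nl) linxyy.
  have wi := lin_inter_wt npq nxy ni hp'.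
  suff : wt (lin p q) m' <= wt (predI (lin p q) (lin x y)) m' + wt (bs x y) m'.
    move: w2 tuv wi; rewrite -(wt_ext m lxy) {2}def_m dm [wt (bs x y) _]wtD !wtD !wtU b; clear; lia.
  by apply: wt_cover => j _ /= ->; rewrite /lin; case: (bs x y j).
have {}hl p q : npar p q -> wt (lin p q) m <= 2 * t + 1.
  by move=> npq; move/existsPn/(_ p)/existsPn/(_ q): no_l; rewrite npq -leqNgt.
have t_gt0 : 0 < t.
  have [i _ mi] : exists2 i, predT i & 0 < m i by apply: wt_gt0; rewrite wtT; lia.
  by apply: leq_trans (hp i); apply: leq_trans mi (wt_ge _ _); apply: par_refl.
suff [x [y [z [b [mx my mz] H]]]] : exists x y z, [/\ bs x y z,
    [/\ 0 < m x, 0 < m y & 0 < m z] &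
    forall p q, npar p q -> wt (lin p q) m = 2 * t + 1 ->
      [|| lin p q x, lin p q y | lin p q z]].
  exists x, y, z; split=> // m' def_m hp' p q npq.
  have := hl _ _ npq; rewrite leq_eqVlt => /orP[/eqP w|].
    by have := H _ _ npq w; move: w; rewrite def_m !wtD !wtU; clear; lia.
  by rewrite def_m !wtD !wtU; clear; lia.
have [/existsP[u /existsP[v /andP[nuv /eqP huv]]]|no_h] :=
    boolP [exists u, exists v, npar u v && (wt (lin u v) m == 2 * t + 1)]; last first.
  have [x _ mx] : exists2 i, predT i & 0 < m i by apply: wt_gt0; rewrite wtT; lia.
  have := wt_par x m; have := hp x => h1 w1.
  have [y nxy my] : exists2 y, npar x y & 0 < m y by apply: wt_gt0; lia.
  have w2 := wt_lin x y m; have h2 := hl _ _ nxy.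
  have [z b mz] : exists2 z, bs x y z & 0 < m z by apply: wt_gt0; lia.
  exists x, y, z; split=> // p q npq w.
  by move/existsPn/(_ p)/existsPn/(_ q): no_h; rewrite npq w eqxx.
have wuv := wt_lin u v m.
have [z bz mz] : exists2 z, bs u v z & 0 < m z by apply: wt_gt0; lia.
(* Off [lin u v] the weight is [t + 2], of which [z] takes at least one. A line of weight
   [2 * t + 1] avoiding [z] must therefore meet [lin u v] in the support of [m], and [x] is chosen
   there. *)
have off_z p q : ~~ lin p q z ->
    wt (predI (lin p q) (bs u v)) m <= t.+1.
  move=> nlz; suff : wt (predI (lin p q) (bs u v)) m + wt (pred1 z) m <= wt (bs u v) m.
    by have := wt_ge m (eqxx z : pred1 z z); clear -mz wuv huv dm; lia.
  apply: wt_disj => [j /andP[]//|j /eqP ->//|j /andP[lj _]].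
  by apply: contraNN nlz => /eqP <-.
have meet p q : wt (lin p q) m <=
    wt (predI (lin p q) (lin u v)) m + wt (predI (lin p q) (bs u v)) m.
  by apply: wt_cover => j _ /= ->; rewrite /lin; case: (bs u v j).
have [/existsP[p /existsP[q /and4P[npq /eqP hpq nlz /existsP[i ni]]]]|no_h] :=
    boolP [exists p, exists q, [&& npar p q, wt (lin p q) m == 2 * t + 1, ~~ lin p q z
                                & [exists i, lin p q i != lin u v i]]].
  have [x /andP[px ux] mx] : exists2 x, predI (lin p q) (lin u v) x & 0 < m x.
    by apply: wt_gt0; have := meet p q; have := off_z p q nlz; clear -hpq t_gt0; lia.
  have [|y [nxy my lxy]] := on_line u v x nuv ux; first by clear -huv t_gt0; lia.
  exists x, y, z; split=> //.
    by apply: contraLR bz => l; rewrite -[~~ _]/(lin u v z) -lxy.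
  move=> r s nrs hrs; apply: contraT; rewrite !negb_or => /and3P[nrx nry nrz].
  have nix : lin r s x != lin u v x by rewrite ux (negPf nrx).
  have ni' : lin r s x != lin p q x by rewrite px (negPf nrx).
  (* Both [lin p q] and [lin r s] have at most [t] on [lin u v], hence at least [t + 1] off it, and
     they share at most [t]. Together they fill the whole [t + 2] off [lin u v], yet both avoid
     [z]. *)
  have := wtUI (predI (lin r s) (bs u v)) (predI (lin p q) (bs u v)) m.
  have := lin_inter_wt nrs nuv nix hp; have := lin_inter_wt npq nuv ni hp.
  have := meet r s; have := meet p q; have := lin_inter_wt nrs npq ni' hp.
  set U := wt (predU _ _) m; set J := wt (predI (predI _ _) (predI _ _)) m.
  have le_J : J <= wt (predI (lin r s) (lin p q)) m.
    by apply: wt_sub => j /andP[/andP[/= -> _] /andP[-> _]].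
  suff : U + wt (pred1 z) m <= wt (bs u v) m.
    by have := wt_ge m (eqxx z : pred1 z z); clear -hrs hpq huv wuv dm mz le_J t_gt0; lia.
  apply: wt_disj => [j|j /eqP ->//|j].
    by case/orP => /andP[].
  by case/orP => /andP[lj _]; [apply: contraNN nrz|apply: contraNN nlz] => /eqP <-.
have [x ux mx] : exists2 x, lin u v x & 0 < m x by apply: wt_gt0; lia.
have [|y [nxy my lxy]] := on_line u v x nuv ux; first by clear -huv t_gt0; lia.
exists x, y, z; split=> //.
  by apply: contraLR bz => l; rewrite -[~~ _]/(lin u v z) -lxy.
move=> p q npq hpq; apply: contraT; rewrite !negb_or => /and3P[nx ny nz].
move/existsPn/(_ p)/existsPn/(_ q): no_h; rewrite npq hpq eqxx nz /=.
by move/existsPn/(_ x); rewrite ux (negPf nx).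
Qed.

(* The integer decomposition property of the base polytope in rank 3. *)
Lemma cond_split t m : cond t.+1 m ->
  exists x y z m', [/\ bs x y z, m = (m' + (U_(x) + U_(y) + U_(z)))%MM & cond t m'].
Proof.
have [d] := ubnP (mdeg m); elim: d m => // d IHd m lt_d cm.
have [dm|lt_m|] := ltngtP (mdeg m) (3 * t.+1); first by case/condP: cm; lia.
  have [i [m1 [def_m c1]]] := cond_reduce cm lt_m.
  have [|x [y [z [m' [b def_m1 c']]]]] := IHd m1 _ c1.
    by move: lt_d; rewrite def_m mdegD mdeg1; lia.
  exists x, y, z, (m' + U_(i))%MM; split=> //.
    by rewrite def_m def_m1 -!addmA [(U_(i) + _)%MM]addmC !addmA.
  move/condP: c' => [h1 h2 h3]; apply/condP; split=> [|u|u v nuv].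
  - by rewrite mdegD; apply: leq_trans h1 (leq_addr _ _).
  - by rewrite wtD; apply: leq_trans (h2 u) (leq_addr _ _).
  - by rewrite wtD; apply: leq_trans (h3 u v nuv) (leq_addr _ _).
exact: cond_split_exact.
Qed.

End Matroid.

(** * Regular sequences and Koszul cohomology *)

Section RegularSequences.

Local Open Scope ring_scope.

Variable R : comNzRingType.
Implicit Types (J N S : R -> Prop) (f g h : R) (s : seq R).

Lemma ideal_sub J f g : is_ideal J -> J f -> J g -> J (f - g).
Proof. by case=> _ JD JM Jf Jg; apply: JD => //; rewrite -mulN1r; apply: JM. Qed.

Lemma ideal_sum J (I : Type) (r : seq I) (P : pred I) (F : I -> R) :
  is_ideal J -> (forall i, P i -> J (F i)) -> J (\sum_(i <- r | P i) F i).
Proof. by case=> J0 JD _ JF; elim/big_ind: _. Qed.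

Lemma gen_ideal_ideal S : is_ideal (gen_ideal S).
Proof.
split=> [|f g [k [a [u [Su ->]]]] [l [b [v [Sv ->]]]]|c f [k [a [u [Su ->]]]]].
- exists 0%N, (fun=> 0), (fun=> 0); split=> [[]//|]; by rewrite big_ord0.
- exists (k + l)%N, (fun i => match split i with inl i => a i | inr i => b i end),
    (fun i => match split i with inl i => u i | inr i => v i end).
  split=> [i|]; first by case: (split i).
  rewrite big_split_ord; congr (_ + _); apply: eq_bigr => i _.
    by rewrite (unsplitK (inl i)).
  by rewrite (unsplitK (inr i)).
- exists k, (fun i => c * a i), u; split=> //; rewrite mulr_sumr.
  by apply: eq_bigr => i _; rewrite mulrA.
Qed.

Lemma mem_gen S f : S f -> gen_ideal S f.
Proof.
by move=> Sf; exists 1%N, (fun=> 1), (fun=> f); split=> //; rewrite big_ord1 mul1r.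
Qed.

Lemma gen_ideal_min S J : is_ideal J -> (forall f, S f -> J f) ->
  forall f, gen_ideal S f -> J f.
Proof.
move=> idJ SJ _ [k [a [u [Su ->]]]]; apply: ideal_sum => // i _.
by case: idJ => _ _; apply; apply/SJ/Su.
Qed.

Definition nzd J f := forall g, J (f * g) -> J g.

(** The ideal [J + (f)], with one explicit cofactor in place of a linear combination. *)
Definition adj J f : R -> Prop := fun h => exists k, J (h - f * k).

Lemma adj_ideal J f : is_ideal J -> is_ideal (adj J f).
Proof.
move=> idJ; case: (idJ) => J0 JD JM; split=> [|g h [k Jk] [l Jl]|a g [k Jk]].
- by exists 0; rewrite mulr0 subr0.
- by exists (k + l); rewrite (_ : _ - _ = (g - f * k) + (h - f * l)); [apply: JD | ring].
- by exists (a * k); rewrite (_ : _ - _ = a * (g - f * k)); [apply: JM | ring].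
Qed.

Lemma adj_ext J N f : (forall h, J h <-> N h) -> forall h, adj J f h <-> adj N f h.
Proof. by move=> JN h; split=> -[k /JN]; exists k. Qed.

Lemma nzd_ext J N f : (forall h, J h <-> N h) -> nzd J f -> nzd N f.
Proof. by move=> JN nz g /JN/nz/JN. Qed.

Lemma add_seq_nil J h : is_ideal J -> add_seq J [::] h <-> J h.
Proof.
move=> idJ; split; last by move=> Jh; apply: mem_gen; left.
by apply: gen_ideal_min => // g [].
Qed.

Lemma add_seq_rcons J s f h : add_seq J (rcons s f) h <-> adj (add_seq J s) f h.
Proof.
have idJ := gen_ideal_ideal (fun g => J g \/ g \in s).
split; last first.
  have [_ JD JM] := gen_ideal_ideal (fun g => J g \/ g \in rcons s f).
  case=> k; rewrite -{2}[h](subrK (f * k)) => Jk; apply: JD.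
    apply: gen_ideal_min Jk => [|g Sg]; first exact: gen_ideal_ideal.
    by apply: mem_gen; case: Sg => [Jg|gs]; [left|right; rewrite mem_rcons inE gs orbT].
  by rewrite mulrC; apply: JM; apply: mem_gen; right; rewrite mem_rcons inE eqxx.
apply: gen_ideal_min => [|g]; first exact: adj_ideal.
rewrite mem_rcons inE => -[Jg|/predU1P[->|gs]].
- by exists 0; rewrite mulr0 subr0; apply: mem_gen; left.
- by exists 1; rewrite mulr1 subrr; case: idJ.
- by exists 0; rewrite mulr0 subr0; apply: mem_gen; right.
Qed.

Lemma add_seq1 J f h : is_ideal J -> add_seq J [:: f] h <-> adj J f h.
Proof.
move=> idJ; apply: iff_trans (add_seq_rcons J [::] f h) _.
by apply: adj_ext => g; apply: add_seq_nil.
Qed.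

Lemma add_seq2 J f g h : is_ideal J -> add_seq J [:: f; g] h <-> adj (adj J f) g h.
Proof.
move=> idJ; apply: iff_trans (add_seq_rcons J [:: f] g h) _.
by apply: adj_ext => ?; apply: add_seq1.
Qed.

Lemma regular_seq_nzd J s : is_ideal J -> regular_seq J s ->
  [/\ (0 < size s)%N -> nzd J s`_0, (1 < size s)%N -> nzd (adj J s`_0) s`_1
    & (2 < size s)%N -> nzd (adj (adj J s`_0) s`_1) s`_2].
Proof.
move=> idJ [reg _]; split=> [lt_s|lt_s|lt_s].
- by apply: nzd_ext (reg 0%N lt_s) => h; rewrite take0; apply: add_seq_nil.
- apply: nzd_ext (reg 1%N lt_s) => h; case: s lt_s {reg} => [|f [|g s]] // _.
  exact: add_seq1.
- apply: nzd_ext (reg 2%N lt_s) => h; case: s lt_s {reg} => [|f [|g [|k s]]] // _.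
  exact: add_seq2.
Qed.

Lemma add_seq_sub J N s : is_ideal N -> (forall f, J f -> N f) ->
  (forall f, f \in s -> N f) -> forall f, add_seq J s f -> N f.
Proof. by move=> idN JN sN; apply: gen_ideal_min => // f []; auto. Qed.

Lemma regular_seq_intro J N s : is_ideal J -> is_ideal N -> ~ N 1 ->
  (forall f, J f -> N f) -> (forall f, f \in s -> N f) ->
  (size s <= 2)%N -> ((0 < size s)%N -> nzd J s`_0) ->
  ((1 < size s)%N -> nzd (adj J s`_0) s`_1) -> regular_seq J s.
Proof.
move=> idJ idN N1 JN sN le2 nz0 nz1; split; last by move/(add_seq_sub idN JN sN).
case=> [|[|i]] lt_i; last by lia.
  by apply: nzd_ext (nz0 lt_i) => h; rewrite take0; apply: iff_sym; apply: add_seq_nil.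
apply: nzd_ext (nz1 lt_i) => h; case: s lt_i {sN le2 nz0 nz1} => [|f [|g s]] // _.
by apply: iff_sym; apply: add_seq1.
Qed.

(* [sigma] identifies the quotient by [f] with a subring over which [J] is extended. *)
Lemma nzd_adj_subst J f g (sigma : R -> R) : is_ideal J ->
  {morph sigma : h k / h * k} -> {morph sigma : h k / h - k} -> sigma f = 0 ->
  (forall h, J h -> J (sigma h)) -> sigma g = g ->
  (forall h, exists k, h - sigma h = f * k) -> nzd J g -> nzd (adj J f) g.
Proof.
move=> idJ sM sB sf sJ sg sh nz h [k Jk]; have [l hl] := sh h.
exists l; rewrite -hl opprB addrC subrK; apply: nz; move/sJ: Jk.
by rewrite sB !sM sf mul0r subr0 sg.
Qed.

Definition capI J N : R -> Prop := fun f => J f /\ N f.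

(* [S] plays the role of [J + N]; [pi] picks the [J]-component of its elements. *)
Definition sum_split J N S (pi : R -> R) :=
  [/\ is_ideal S, forall f, J f -> S f, forall f, N f -> S f,
      forall f, pi (- f) = - pi f & forall f, S f -> J (pi f) /\ N (f - pi f)].

(** The map from [R / capI J N] to the sum of [R / J] and [R / N] has cokernel [R / S], on which [f]
    is regular, so it stays injective modulo [f]. Concretely, the cofactors [k1] and [k2] differ by
    an element of [S], and [pi] splits this difference to merge them into one. *)
Lemma nzd_adj_cap J N S pi f g : is_ideal J -> is_ideal N -> sum_split J N S pi ->
  nzd S f -> nzd (adj J f) g -> nzd (adj N f) g -> nzd (adj (capI J N) f) g.
Proof.
move=> idJ idN [idS JS NS _ piP] nzf nzJ nzN h [k [Jk Nk]].
have [k1 J1] := nzJ h (ex_intro _ k Jk); have [k2 N2] := nzN h (ex_intro _ k Nk).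
have /piP[J3 N3] : S (k2 - k1).
  apply: nzf; rewrite (_ : _ * _ = (h - f * k1) - (h - f * k2)); last by ring.
  by apply: ideal_sub => //; [apply: JS | apply: NS].
exists (k1 + pi (k2 - k1)); split.
  rewrite (_ : _ - _ = (h - f * k1) - f * pi (k2 - k1)); last by ring.
  by apply: ideal_sub => //; case: idJ => _ _; apply.
rewrite (_ : _ - _ = (h - f * k2) + f * (k2 - k1 - pi (k2 - k1))); last by ring.
by case: idN => _ ND NM; apply: ND => //; apply: NM.
Qed.

End RegularSequences.

Section Koszul.

Local Open Scope ring_scope.

Variables (R : comNzRingType) (n : nat) (x : 'I_n -> R).
Implicit Types (J N S : R -> Prop) (f g h : R).

(* [kos_i J]: the Koszul cohomology of [x] on [R / J] vanishes in degree [i]. *)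
Definition kos0 J := forall s, (forall i, J (x i * s)) -> J s.

Definition kos1 J := forall a : 'I_n -> R, (forall i j, J (x j * a i - x i * a j)) ->
  exists u, forall i, J (a i - x i * u).

Definition kos2 J := forall d : 'I_n -> 'I_n -> R, (forall i j, d i j = - d j i) ->
  (forall i j k, J (x k * d i j - x j * d i k + x i * d j k)) ->
  exists b : 'I_n -> R, forall i j, J (d i j - (x j * b i - x i * b j)).

Lemma gen_linear f : gen_ideal (fun f => exists i, f = x i) f ->
  exists c : 'I_n -> R, f = \sum_k c k * x k.
Proof.
move: f; apply: gen_ideal_min => [|_ [i ->]].
  split=> [|_ _ [c ->] [e ->]|a _ [c ->]].
  - by exists (fun=> 0); rewrite big1 // => i _; rewrite mul0r.
  - by exists (fun i => c i + e i); rewrite -big_split; apply: eq_bigr => i _; rewrite mulrDl.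
  - by exists (fun i => a * c i); rewrite mulr_sumr; apply: eq_bigr => i _; rewrite mulrA.
exists (fun k => (k == i)%:R); rewrite (bigD1 i) //= eqxx mul1r big1 ?addr0 // => k /negPf ->.
by rewrite mul0r.
Qed.

Variables (f : R) (c : 'I_n -> R).
Hypothesis def_f : f = \sum_k c k * x k.

(* Each [kos_i_nzd] uses that [f] acts as zero on Koszul cohomology: contraction with [c]
   is a homotopy between multiplication by [f] and zero. *)
Lemma kos0_nzd J : is_ideal J -> nzd J f -> kos0 J.
Proof.
move=> idJ nz s Js; apply: nz; rewrite def_f mulr_suml; apply: ideal_sum => // i _.
by rewrite -mulrA; case: idJ => _ _; apply.
Qed.

Lemma kos1_nzd J : is_ideal J -> nzd J f -> kos0 (adj J f) -> kos1 J.
Proof.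
move=> idJ nz K a cyc; case: (idJ) => _ JD JM; pose w := \sum_k c k * a k.
have Jw i : J (x i * w - f * a i).
  rewrite def_f mulr_sumr mulr_suml -sumrB; apply: ideal_sum => // k _.
  by rewrite (_ : _ - _ = c k * (x i * a k - x k * a i)); [apply: JM | ring].
have [u Ju] : adj J f w by apply: K => i; exists (a i).
exists u => i; apply: nz.
rewrite (_ : _ * _ = x i * (w - f * u) - (x i * w - f * a i)); last by ring.
by apply: ideal_sub => //; apply: JM.
Qed.

Lemma kos2_nzd J : is_ideal J -> nzd J f -> kos1 (adj J f) -> kos2 J.
Proof.
move=> idJ nz K d alt cyc; case: (idJ) => _ JD JM.
pose w i := - \sum_k c k * d k i.
have Jw i j : J (x j * w i - x i * w j - f * d i j).
  rewrite (_ : _ - _ = - \sum_k c k * (x k * d i j - x j * d i k + x i * d j k)); last first.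
    rewrite def_f /w mulr_suml !mulrN !mulr_sumr -!sumrN -!big_split /=.
    by apply: eq_bigr => k _; rewrite (alt k i) (alt k j); ring.
  by rewrite -mulN1r; apply: (JM); apply: ideal_sum => // k _; apply: JM.
have [i j|u Ku] := K w; first by exists (d i j).
have [b Jb] := fin_all_exists Ku; exists b => i j; apply: nz.
rewrite (_ : _ * _ = x j * (w i - x i * u - f * b i) - x i * (w j - x j * u - f * b j)
   - (x j * w i - x i * w j - f * d i j)); last by ring.
by apply: ideal_sub => //; apply: ideal_sub => //; apply: JM.
Qed.

End Koszul.

Section MayerVietoris.

Local Open Scope ring_scope.

Variables (R : comNzRingType) (n : nat) (x : 'I_n -> R).
Variables (J N S : R -> Prop) (pi : R -> R).
Hypotheses (idJ : is_ideal J) (idN : is_ideal N) (JNS : sum_split J N S pi).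

(** The family [p] is the image of [s] under the connecting map. If [v] bounds it modulo [capI J N],
    then the variables multiply [v] into [J] and [s - v] into [N]. *)
Lemma kos0_sum : kos1 x (capI J N) -> kos0 x J -> kos0 x N -> kos0 x S.
Proof.
case: JNS => idS JS NS _ piP K1 KJ KN s Ss; pose p i := pi (x i * s).
case: (idJ) (idN) (idS) => _ JD JM [_ ND NM] [_ SD SM].
have [Jp Nq] : (forall i, J (p i)) /\ (forall i, N (x i * s - p i)).
  by split=> i; have [] := piP _ (Ss i).
have [i j|v Jv] := K1 p.
  split; first by apply: ideal_sub => //; apply: JM.
  rewrite (_ : _ - _ = x i * (x j * s - p j) - x j * (x i * s - p i)); last by ring.
  by apply: ideal_sub => //; apply: NM.
rewrite -(subrK v s); apply: SD.
  apply: NS; apply: KN => i; have [_ Ni] := Jv i.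
  by rewrite (_ : _ * _ = (x i * s - p i) + (p i - x i * v)); [apply: ND | ring].
apply: JS; apply: KJ => i; have [Ji _] := Jv i.
by rewrite (_ : _ * _ = p i - (p i - x i * v)); [apply: ideal_sub | ring].
Qed.

(** One degree higher: if [b] bounds the connecting cocycle [p], then [b] is a cocycle modulo [J]
    and [s - b] one modulo [N]; their bounding elements add up. *)
Lemma kos1_sum : kos2 x (capI J N) -> kos1 x J -> kos1 x N -> kos1 x S.
Proof.
case: JNS => idS JS NS piN piP K2 KJ KN s Ss; pose p i j := pi (x j * s i - x i * s j).
case: (idJ) (idN) (idS) => _ JD JM [_ ND NM] [_ SD SM].
pose q i j := (x j * s i - x i * s j) - p i j.
have Jp i j : J (p i j) by have [] := piP _ (Ss i j).
have Nq i j : N (q i j) by have [] := piP _ (Ss i j).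
have [i j|i j k|b Jb] := K2 p; first by rewrite /p -piN opprB.
  split.
    by apply: JD; [apply: ideal_sub => // |]; apply: JM.
  rewrite (_ : _ + _ = x j * q i k - x k * q i j - x i * q j k); last by rewrite /q; ring.
  by apply: ideal_sub => //; [apply: ideal_sub => // |]; apply: NM.
have [i j|v Jv] := KJ b.
  rewrite (_ : _ - _ = p i j - (p i j - (x j * b i - x i * b j))); last by ring.
  by apply: ideal_sub => //; have [] := Jb i j.
have [i j|v' Nv] := KN (fun i => s i - b i).
  rewrite (_ : _ - _ = q i j + (p i j - (x j * b i - x i * b j))); last by rewrite /q; ring.
  by apply: ND => //; have [] := Jb i j.
exists (v + v') => i; rewrite (_ : _ - _ = (b i - x i * v) + (s i - b i - x i * v')); last by ring.
by apply: SD; [apply: JS | apply: NS].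
Qed.

End MayerVietoris.

Section DepthBounds.

Local Open Scope ring_scope.

Variables (R : comNzRingType) (n : nat) (x : 'I_n -> R) (J : R -> Prop) (s : seq R).
Hypotheses (idJ : is_ideal J)
  (s_x : forall f, f \in s -> gen_ideal (fun f => exists i, f = x i) f)
  (reg : regular_seq J s).

Lemma regular_seq_kos1 : (1 < size s)%N -> kos1 x J.
Proof.
move=> lt1; have [nz0 nz1 _] := regular_seq_nzd idJ reg.
have [c0 d0] := gen_linear (s_x (mem_nth 0 (ltnW lt1))).
have [c1 d1] := gen_linear (s_x (mem_nth 0 lt1)).
apply: (kos1_nzd d0) => //; first exact/nz0/ltnW.
by apply: (kos0_nzd d1); [apply: adj_ideal | apply: nz1].
Qed.

Lemma regular_seq_kos2 : (2 < size s)%N -> kos2 x J.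
Proof.
move=> lt2; have lt1 := ltnW lt2; have [nz0 nz1 nz2] := regular_seq_nzd idJ reg.
have [c0 d0] := gen_linear (s_x (mem_nth 0 (ltnW lt1))).
have [c1 d1] := gen_linear (s_x (mem_nth 0 lt1)).
have [c2 d2] := gen_linear (s_x (mem_nth 0 lt2)).
apply: (kos2_nzd d0) => //; first exact/nz0/ltnW.
apply: (kos1_nzd d1); [exact: adj_ideal | exact: nz1|].
by apply: (kos0_nzd d2); [do 2!apply: adj_ideal | apply: nz2].
Qed.

End DepthBounds.

(** * Monomial ideals *)

Section MonomialMembership.

Local Open Scope ring_scope.

Variables (K : fieldType) (n : nat).
Local Notation R := {mpoly K[n]}.
Implicit Types (C D : pred 'X_{1..n}) (m u : 'X_{1..n}) (f g h : R) (V : pred 'I_n).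

(** Encoding a monomial ideal by the predicate of its monomials makes sums and intersections of
    ideals the Boolean operations [||] and [&&]. *)
Definition nm C : R -> Prop := fun f => forall m, m \in msupp f -> C m.

Definition upc C := forall m m', C m -> C (m + m')%MM.

Lemma nmX C m : nm C 'X_[m] <-> C m.
Proof. by rewrite /nm msuppX; split=> [|Cm u]; [apply; rewrite inE | rewrite inE => /eqP ->]. Qed.

Lemma nm_imp C D f : (forall m, C m -> D m) -> nm C f -> nm D f.
Proof. by move=> CD Cf m /Cf/CD. Qed.

Lemma nm_ext C D f : C =1 D -> nm C f <-> nm D f.
Proof. by move=> CD; split; apply: nm_imp => m; rewrite CD. Qed.

Lemma nm_ideal C : upc C -> is_ideal (nm C).
Proof.
move=> upC; split=> [m|f g Cf Cg m /msuppD_le|a f Cf m /msuppM_le/allpairsP[[m1 m2] /= [_ mf ->]]].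
- by rewrite msupp0.
- by rewrite mem_cat => /orP[/Cf|/Cg].
- by rewrite addmC; apply/upC/Cf.
Qed.

Lemma ideal_nm_min C (J : R -> Prop) f :
  is_ideal J -> (forall m, C m -> J 'X_[m]) -> nm C f -> J f.
Proof.
move=> idJ CJ Cf; rewrite [f]mpolyE big_seq; apply: ideal_sum => // m mf.
by rewrite -mul_mpolyC; case: idJ => _ _; apply; apply/CJ/Cf.
Qed.

Lemma nm_mulX C f u : nm C (f * 'X_[u]) <-> nm (fun m => C (u + m)%MM) f.
Proof.
split=> Cf m mf; first by apply: Cf; rewrite (perm_mem (msuppMX _ _)) map_f.
by move: mf; rewrite (perm_mem (msuppMX _ _)) => /mapP[m' /Cf ? ->].
Qed.

Definition part C f : R := \sum_(m <- msupp f | C m) f@_m *: 'X_[m].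

Lemma part_coef C f m : (part C f)@_m = if C m then f@_m else 0.
Proof.
have E u : (if C u then f@_u *: 'X_[u] else 0 : R)@_m = f@_u * (C u && (u == m))%:R.
  by case: (C u); rewrite ?mcoeff0 ?mulr0 // mcoeffZ mcoeffX.
rewrite /part big_mkcond raddf_sum /= (eq_bigr _ (fun u _ => E u)).
have [mf|nmf] := boolP (m \in msupp f); last first.
  rewrite (memN_msupp_eq0 nmf) if_same big_seq big1 // => u uf.
  by case: eqP uf nmf => [-> ->|_ _ _] //; rewrite andbF mulr0.
rewrite (bigD1_seq m) //= eqxx andbT big1 ?addr0 => [|u /negPf ->].
  by case: (C m); rewrite ?mulr1 ?mulr0.
by rewrite andbF mulr0.
Qed.

Lemma msupp_part C f m : (m \in msupp (part C f)) = C m && (m \in msupp f).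
Proof. by rewrite !mcoeff_msupp part_coef; case: (C m); rewrite ?eqxx. Qed.

Lemma nm_part C f : nm C (part C f).
Proof. by move=> m; rewrite msupp_part => /andP[]. Qed.

Lemma partN C f : part C (- f) = - part C f.
Proof.
by apply/mpolyP => m; rewrite mcoeffN !part_coef mcoeffN; case: (C m); rewrite ?oppr0.
Qed.

Lemma part_complement C f : f - part C f = part (predC C) f.
Proof.
apply/mpolyP => m; rewrite mcoeffB !part_coef /=.
by case: (C m); rewrite ?subrr ?subr0.
Qed.

Lemma nm_part0 C f : part (predC C) f = 0 -> nm C f.
Proof.
move=> p0 m mf; apply: contraT => nCm.
by have := msupp_part (predC C) f m; rewrite p0 msupp0 mf /= nCm.
Qed.

Lemma nm_sum_split C D : upc C -> upc D ->
  sum_split (nm C) (nm D) (nm (fun m => C m || D m)) (part C).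
Proof.
move=> upC upD; split.
- by apply: nm_ideal => m m' /orP[/upC ->|/upD ->] //; rewrite orbT.
- by move=> f; apply: nm_imp => m ->.
- by move=> f; apply: nm_imp => m ->; rewrite orbT.
- exact: partN.
- move=> f CDf; split; first exact: nm_part.
  rewrite part_complement => m; rewrite msupp_part => /andP[/negPf nC /CDf].
  by rewrite nC.
Qed.

Lemma nm_capI C D f : capI (nm C) (nm D) f <-> nm (fun m => C m && D m) f.
Proof.
split=> [[Cf Df] m mf|CDf]; first by rewrite Cf ?Df.
by split=> m /CDf/andP[].
Qed.

(** For upward closed [C]: no minimal generator of the ideal involves the variable of index [b]. *)
Definition free_var C b := forall m, C (m + U_(b))%MM -> C m.

(* Compare the terms of maximal degree in [b]. *)
Lemma nzd_monic_var C b f' : upc C -> free_var C b ->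
  (forall m, m \in msupp f' -> m b = 0%N) -> nzd (nm C) ('X_b + f').
Proof.
move=> upC freeb f'b g Cfg; apply: nm_part0; set h := part _ g.
have [_ CD CM] := nm_ideal upC.
have Cfh : nm C (('X_b + f') * h).
  rewrite /h -part_complement mulrBr; apply: (ideal_sub (nm_ideal upC)) => //.
  exact/CM/nm_part.
apply/eqP; rewrite -msupp_eq0; case def_s: (msupp h) => [//|m0 s0].
have m0h : m0 \in msupp h by rewrite def_s mem_head.
have [m mh max_m] : exists2 m, m \in msupp h & forall u, u \in msupp h -> (u b <= m b)%N.
  elim: (msupp h) m0 m0h {def_s} => // a s IHs m0 _.
  case: s IHs => [|a' s] IHs; first by exists a; rewrite ?inE // => u /[!inE] /eqP ->.
  have [m ms max_m] := IHs a' (mem_head _ _).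
  have [le_am|lt_ma] := leqP (a b) (m b).
    by exists m => [|u]; rewrite inE ?ms ?orbT // => /predU1P[->|/max_m].
  exists a => [|u]; rewrite inE ?eqxx // => /predU1P[->//|/max_m /leq_trans -> //].
  exact: ltnW.
have := mh; rewrite msupp_part => /andP[/negP nCm _]; case: nCm; apply/freeb/Cfh.
rewrite mcoeff_msupp mulrDl mcoeffD mulrC addmC mcoeffMX.
rewrite [X in _ + X](_ : _ = 0) ?addr0 -?mcoeff_msupp //.
apply: memN_msupp_eq0; apply/negP => /msuppM_le/allpairsP[[m1 m2] /= [m1f m2h def_m]].
have := max_m _ m2h; have /(congr1 (fun u : 'X_{1..n} => u b)) := def_m.
by rewrite !mnmDE (f'b _ m1f) mnm1E eqxx; lia.
Qed.

Lemma nzd_var C b : upc C -> free_var C b -> nzd (nm C) 'X_b.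
Proof.
by move=> upC freeb; rewrite -['X_b]addr0; apply: nzd_monic_var => // m; rewrite msupp0.
Qed.

Lemma var_ideal (i : 'I_n) : gen_ideal (fun f : R => exists i, f = 'X_i) 'X_i.
Proof. by apply: mem_gen; exists i. Qed.

Lemma nm_kos0 C b : upc C -> free_var C b -> kos0 (fun i => 'X_i : R) (nm C).
Proof. by move=> upC freeb s; move/(_ b); apply: nzd_var. Qed.

Lemma upc_or C D : upc C -> upc D -> upc (fun m => C m || D m).
Proof. by move=> upC upD m m' /orP[/upC ->|/upD ->] //; rewrite orbT. Qed.

Lemma upc_and C D : upc C -> upc D -> upc (fun m => C m && D m).
Proof. by move=> upC upD m m' /andP[/upC -> /upD ->]. Qed.

Lemma upc_wt V k : upc (fun m => k <= wt V m)%N.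
Proof. by move=> m m' le_k; rewrite wtD; apply: leq_trans le_k (leq_addr _ _). Qed.

Lemma free_wt V k b : ~~ V b -> free_var (fun m => k <= wt V m)%N b.
Proof. by move=> /negPf Vb m; rewrite wtD wtU Vb addn0. Qed.

Lemma free_or C D b : free_var C b -> free_var D b -> free_var (fun m => C m || D m) b.
Proof. by move=> fC fD m /orP[/fC ->|/fD ->] //; rewrite orbT. Qed.

Lemma free_and C D b : free_var C b -> free_var D b -> free_var (fun m => C m && D m) b.
Proof. by move=> fC fD m /andP[/fC -> /fD ->]. Qed.

Lemma adj_nm_var C b h : upc C ->
  adj (nm C) 'X_b h <-> nm (fun m => C m || (0 < m b)%N) h.
Proof.
move=> upC; split.
  case=> k Ck; rewrite -[h](subrK ('X_b * k)).
  have [_ D _] : is_ideal (nm (fun m => C m || (0 < m b)%N)).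
    by apply: nm_ideal => m m' /orP[/upC -> //|mb]; rewrite mnmDE ltn_addr ?orbT.
  apply: D; first by apply: nm_imp Ck => m ->.
  move=> m; rewrite mulrC (perm_mem (msuppMX _ _)) => /mapP[m' _ ->].
  by rewrite mnmDE mnm1E eqxx orbT.
apply: (ideal_nm_min (adj_ideal _ (nm_ideal upC))) => m /orP[Cm|/mnm_decr[m' ->]].
  by exists 0; rewrite mulr0 subr0; apply/nmX.
by exists 'X_[m']; rewrite mpolyXD mulrC subrr; case: (nm_ideal upC).
Qed.

(** The two free variables form a regular sequence: adjoining the first leaves a monomial ideal in
    which the second is still free. *)
Lemma nm_kos1 C b b' : upc C -> b != b' -> free_var C b -> free_var C b' ->
  kos1 (fun i => 'X_i : R) (nm C).
Proof.
move=> upC bb' fb fb'; have [c def_b] := gen_linear (var_ideal b).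
apply: (kos1_nzd def_b); [exact: nm_ideal | exact: nzd_var|].
move=> s /(_ b') Cs; apply/adj_nm_var => //; move/adj_nm_var: Cs => /(_ upC).
apply: nzd_var => [m m'|m]; first by case/orP => [/upC -> //|mb]; rewrite mnmDE ltn_addr ?orbT.
by case/orP => [/fb' -> //|]; rewrite mnmDE mnm1E eq_sym (negPf bb') addn0 => ->; rewrite orbT.
Qed.

Lemma irrelevant_nm f : irrelevant_ideal f -> nm (fun m => 0 < wt predT m)%N f.
Proof.
apply: gen_ideal_min => [|_ [i ->]]; first exact/nm_ideal/upc_wt.
by apply/nmX; rewrite wtU.
Qed.

Lemma socle_not_nzd C u f : ~~ C u -> (forall i, C (u + U_(i))%MM) -> upc C ->
  irrelevant_ideal f -> ~ nzd (nm C) f.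
Proof.
move=> nCu Cu upC /irrelevant_nm mf nz; case/negP: nCu; apply/nmX/nz/nm_mulX => m /mf.
by case/wt_gt0 => i _ /mnm_decr[m' ->]; rewrite [(m' + _)%MM]addmC addmA; apply: upC.
Qed.

Lemma socle_not_kos0 C u : ~~ C u -> (forall i, C (u + U_(i))%MM) ->
  ~ kos0 (fun i => 'X_i : R) (nm C).
Proof.
move=> nCu Cu K0; case/negP: nCu; apply/nmX/K0 => i.
by rewrite -mpolyXD addmC; apply/nmX.
Qed.

End MonomialMembership.

Section AssociatedPrimes.

Local Open Scope ring_scope.

Variables (K : fieldType) (n : nat).
Local Notation R := {mpoly K[n]}.
Implicit Types (C : pred 'X_{1..n}) (m u : 'X_{1..n}) (f g h : R) (V : pred 'I_n).

Lemma nm_lead C f g : upc C -> nm C (f * g) -> f != 0 -> g != 0 ->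
  C (mlead f + mlead g)%MM.
Proof. by move=> upC Cfg f0 g0; apply: Cfg; rewrite -mleadM // mlead_supp // mulf_neq0. Qed.

Definition pv V : pred 'X_{1..n} := fun m => (0 < wt V m)%N.

Lemma upc_pv V : upc (pv V). Proof. exact: upc_wt. Qed.

(** After the terms lying in the ideal are dropped from both factors, the leading monomial of the
    product avoids [V], unless one factor has become zero. *)
Lemma prime_pv V : prime_ideal (nm (pv V) : R -> Prop).
Proof.
have idV := nm_ideal K (@upc_pv V); case: (idV) => _ VD VM.
split=> // [|f g Vfg].
  by rewrite -mpolyX0 => /nmX; rewrite /pv /wt big1 // => i _; rewrite mnm0E.
have rest h : nm (pv V) h \/ part (predC (pv V)) h != 0.
  by have [/nm_part0|] := eqVneq (part (predC (pv V)) h) 0; [left | right].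
case: (rest f) => [|f0]; first by left.
case: (rest g) => [|g0]; first by right.
have : nm (pv V) (part (predC (pv V)) f * part (predC (pv V)) g).
  rewrite -!part_complement mulrBl !mulrBr.
  apply: (ideal_sub idV); last by apply: (ideal_sub idV); rewrite 1?mulrC;
    apply/VM/nm_part.
  by apply: (ideal_sub idV) => //; apply/VM/nm_part.
move/(nm_lead (@upc_pv V))/(_ f0 g0); rewrite /pv wtD.
have := mlead_supp f0; have := mlead_supp g0.
by rewrite !msupp_part /= /pv -!eqn0Ngt => /andP[/eqP -> _] /andP[/eqP -> _].
Qed.

(* [C] does not distinguish exponents above [b]. *)
Definition saturated C b := forall m i, (b <= m i)%N -> C (m + U_(i))%MM -> C m.

(* For saturated [C], the annihilator of ['X_[u]] modulo [nm C] is generated by the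
   variables in [V]. *)
Definition witness C b V u :=
  [/\ ~~ C u, forall i, V i -> C (u + U_(i))%MM & forall i, ~~ V i -> (b <= u i)%N].

(** Only variables outside [V] divide [m]. Their exponents in [u] are already at least [b], so
    saturation strips them off one at a time. *)
Lemma witness_add C b V u m : saturated C b -> witness C b V u -> ~~ pv V m ->
  ~~ C (u + m)%MM.
Proof.
move=> satC [nCu _ geb]; have [d] := ubnP (mdeg m).
elim: d m => // d IHd m lt_d nVm; have [m0|] := posnP (mdeg m).
  by move/eqP: m0; rewrite mdeg_eq0 => /eqP ->; rewrite addm0.
rewrite -wtT => /wt_gt0[i _ /mnm_decr[m' def_m]].
have nVi : ~~ V i by apply: contra nVm; rewrite def_m /pv wtD wtU => ->; rewrite addn1.
have nVm' : ~~ pv V m' by apply: contra nVm; rewrite def_m; apply: upc_pv.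
have : ~~ C (u + m')%MM by apply: IHd => //; move: lt_d; rewrite def_m mdegD mdeg1; lia.
apply: contra; rewrite def_m addmA; apply: satC.
by rewrite mnmDE (leq_trans (geb i nVi)) ?leq_addr.
Qed.

Lemma prime_X (P : R -> Prop) m : prime_ideal P -> P 'X_[m] ->
  exists2 i, (0 < m i)%N & P 'X_i.
Proof.
case=> _ P1 PM; have [d] := ubnP (mdeg m); elim: d m => // d IHd m lt_d Pm.
have [m0|] := posnP (mdeg m).
  by case: P1; move/eqP: m0 Pm; rewrite mdeg_eq0 => /eqP ->; rewrite mpolyX0.
rewrite -wtT => /wt_gt0[i _ mi]; have [m' def_m] := mnm_decr mi.
move: Pm; rewrite def_m mpolyXD => /PM[Pm'|Pi]; last by exists i; rewrite // -def_m.
case: (IHd m') => // [|j m'j Pj]; last by exists j; rewrite // mnmDE ltn_addr.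
by move: lt_d; rewrite def_m mdegD mdeg1; lia.
Qed.

(** An arbitrary [f] with annihilator [P] is modified, without changing the annihilator, until every
    monomial in its support is a witness. *)
Lemma Ass_nm C b (P : R -> Prop) : upc C -> saturated C b ->
  Ass (nm C) P <-> exists V u, witness C b V u /\ forall g, P g <-> nm (pv V) g.
Proof.
move=> upC satC; have idC := nm_ideal K upC; have [_ CD CM] := idC.
split=> [[primeP [f Pf]] | [V [u [wit PV]]]]; last first.
  split.
    have [[V0 VD VM] V1 VP] := prime_pv V.
    split=> [||g h /PV/VP[]/PV]; [|by move/PV|by left|by right].
    by split=> [|g h /PV Vg /PV Vh|a g /PV Vg]; apply/PV; [|apply: VD|apply: VM].
  exists 'X_[u] => g; apply: iff_trans (PV g) _; rewrite /colon_ideal nm_mulX.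
  split=> Vg m /Vg; last by apply: contraTT => /(witness_add satC wit).
  case/wt_gt0 => i Vi /mnm_decr[m' ->]; rewrite [(m' + _)%MM]addmC addmA; apply: upC.
  by case: wit => _ + _; apply.
have [idP P1 PM] := primeP; have [_ PD PMl] := idP.
pose V : pred 'I_n := fun i => if excluded_middle_informative (P 'X_i) then true else false.
have VP i : V i <-> P 'X_i by rewrite /V; case: excluded_middle_informative.
(* Multiplying by variables outside [P] preserves the annihilator, and exponent [b] gives the size
   that [witness] asks for outside [V]. *)
pose w : 'X_{1..n} := [multinom (if V i then 0 else b)%N | i < n].
have Pw g : P (g * 'X_[w]) <-> P g.
  split=> [/PM[//|/(prime_X primeP)[i]]|Pg]; last by rewrite mulrC; apply: PMl.
  by rewrite mnmE => wi /VP Vi; rewrite Vi in wi.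
pose h := part (predC C) (f * 'X_[w]).
have Ph g : P g <-> nm C (g * h).
  apply: iff_trans (iff_sym (Pw g)) _; apply: iff_trans (Pf _) _.
  rewrite /colon_ideal -mulrA ['X_[w] * f]mulrC -[f * _](subrK (part C (f * 'X_[w]))).
  rewrite part_complement -/h mulrDr; split=> [Ch|Ch]; last by apply/CD/CM/nm_part.
  rewrite -[g * h](addrK (g * part C (f * 'X_[w]))); apply: (ideal_sub idC) => //.
  exact/CM/nm_part.
have h0 : h != 0.
  by apply/eqP => h0; apply/P1/Ph; rewrite h0 mulr0; case: idC.
have wit u : u \in msupp h -> witness C b V u.
  move=> uh; have := uh; rewrite msupp_part => /andP[nCu uf]; split=> // [i /VP/Ph Ci|i Vi].
    apply: Ci; rewrite mulrC (perm_mem (msuppMX _ _)) addmC; exact: map_f.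
  move: uf; rewrite (perm_mem (msuppMX _ _)) => /mapP[u' _ ->].
  by rewrite mnmDE mnmE (negPf Vi) leq_addr.
exists V, (mlead h); split; first exact/wit/mlead_supp.
have VinP g : nm (pv V) g -> P g.
  apply: ideal_nm_min => // m /wt_gt0[i /VP Pi /mnm_decr[m' ->]].
  by rewrite mpolyXD; apply: PMl.
move=> g; split=> [Pg|]; last exact: VinP.
apply: nm_part0; apply/eqP; apply: contraT => g0.
(* The part of [g] free of [V] multiplies [h] into the ideal; its leading monomial times that of [h]
   contradicts [witness_add]. *)
have /Ph/nm_lead : P (part (predC (pv V)) g).
  by rewrite -part_complement; apply: (ideal_sub idP) => //; apply/VinP/nm_part.
move=> /(_ upC g0 h0); rewrite addmC; apply: contraTT => _.
apply: witness_add satC (wit _ (mlead_supp h0)) _.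
by have := mlead_supp g0; rewrite msupp_part => /andP[].
Qed.

End AssociatedPrimes.

(** * Explicit linear forms as nonzerodivisors *)

Section Substitution.

Local Open Scope ring_scope.

Variables (K : fieldType) (n : nat).
Local Notation R := {mpoly K[n]}.
Implicit Types (C : pred 'X_{1..n}) (m : 'X_{1..n}) (g h : R) (b p q : 'I_n).

Lemma sum_varE b : \sum_i 'X_i = 'X_b + \sum_(i | i != b) 'X_i :> R.
Proof. by rewrite (bigD1 b). Qed.

Lemma nzd_sum_var C b : upc C -> free_var C b -> nzd (nm C) (\sum_i 'X_i : R).
Proof.
move=> upC fb; rewrite (sum_varE b); apply: nzd_monic_var => // m /msupp_sum_le.
case/flattenP => s /mapP[i]; rewrite mem_filter => /andP[ib _] ->.
by rewrite msuppX inE => /eqP ->; rewrite mnm1E (negPf ib).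
Qed.

Lemma nzd_var2 C b p : upc C -> b != p -> free_var C b -> nzd (nm C) ('X_b + 'X_p : R).
Proof.
move=> upC bp fb; apply: nzd_monic_var => // m.
by rewrite msuppX inE => /eqP ->; rewrite mnm1E eq_sym (negPf bp).
Qed.

(* Eliminate [x_b] by means of the linear form [\sum_i x_i]. *)
Lemma nzd_adj_sum_var (V : pred 'I_n) k b p q : p != q -> p != b -> q != b ->
  ~~ V b -> ~~ V p -> nzd (adj (nm (fun m => k <= wt V m)%N) (\sum_i 'X_i)) ('X_p + 'X_q : R).
Proof.
move=> pq pb qb Vb Vp; set f : R := \sum_i _.
pose sigma h : R := h \mPo [tuple if i == b then 'X_b - f else 'X_i | i < n].
have sX i : sigma 'X_i = if i == b then 'X_b - f else 'X_i.
  by rewrite /sigma comp_mpolyXU -tnth_nth tnth_mktuple.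
have sB : {morph sigma : h k / h - k} by move=> h l; rewrite /sigma raddfB.
have sM : {morph sigma : h k / h * k} by move=> h l; rewrite /sigma rmorphM.
have upV : upc (fun m => k <= wt V m)%N by apply: upc_wt.
have idV := nm_ideal K upV.
apply: (@nzd_adj_subst _ _ _ _ sigma) => //.
- rewrite /f /sigma raddf_sum /= (bigD1 b) //= -/(sigma _) sX eqxx.
  rewrite (eq_bigr (fun i : 'I_n => 'X_i : R)) => [|i ib].
    by rewrite addrAC -sum_varE subrr.
  by rewrite -/(sigma _) sX (negPf ib).
(* Since [b] is outside [V], [sigma] fixes the factor of a monomial in the variables of [V], and
   this factor carries the whole weight. *)
- move=> h; apply: (@ideal_nm_min _ _ _ (fun h => nm _ (sigma h))) => [|m Vm].
    have [V0 VD VM] := idV.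
    split=> [|g l Vg Vl|a g Vg]; first by rewrite /sigma raddf0.
      by rewrite /sigma raddfD; apply: VD.
    by rewrite sM; apply: VM.
  rewrite mpolyXE_id /sigma rmorph_prod /= (bigID V) /= mulrC.
  case: idV => _ _ VM; apply: VM.
  rewrite (eq_bigr (fun i : 'I_n => 'X_[U_(i) *+ m i] : R)) => [|i Vi]; last first.
    rewrite rmorphXn /= -/(sigma _) sX; case: eqP Vi => [->|_ _]; first by rewrite (negPf Vb).
    by rewrite mpolyXn.
  rewrite -(big_morph _ (@mpolyXD n K) (@mpolyX0 n K)); apply/nmX.
  apply: leq_trans Vm _; rewrite leq_eqVlt; apply/orP; left.
  rewrite eq_sym; apply/eqP; apply: eq_bigr => j Vj; rewrite mnm_sumE (bigD1 j) //= big1 ?addn0.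
    by rewrite mulmnE mnm1E eqxx mul1n.
  by move=> i /andP[_ /negPf ij]; rewrite mulmnE mnm1E ij.
- by rewrite /sigma raddfD /= -!/(sigma _) !sX (negPf pb) (negPf qb).
(* Congruence of [h] and [sigma h] modulo [f] holds for variables and passes to products and
   sums. *)
- have sD : {morph sigma : h k / h + k} by move=> h l; rewrite /sigma raddfD.
  have sC c : sigma c%:MP = c%:MP by rewrite /sigma comp_mpolyC.
  have s0 : sigma 0 = 0 by rewrite /sigma raddf0.
  have s1 : sigma 1 = 1 by rewrite /sigma rmorph1.
  clearbody sigma; clear -sX sM sD sC s0 s1.
  have subf g h : (exists k, g - sigma g = f * k) -> (exists k, h - sigma h = f * k) ->
      exists k, g * h - sigma (g * h) = f * k.
    move=> [k1 e1] [k2 e2]; exists (k1 * h + sigma g * k2).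
    by rewrite sM mulrDr mulrA -e1 mulrCA -e2; ring.
  have sub1 : exists k, 1 - sigma 1 = f * k by exists 0; rewrite s1 subrr mulr0.
  elim/mpolyind => [|c m g _ _ [k1 e1]]; first by exists 0; rewrite s0 subr0 mulr0.
  have [l el] : exists k, 'X_[m] - sigma 'X_[m] = f * k.
    rewrite mpolyXE_id; elim/big_ind: _ => [//|g1 h1|i _]; first exact: subf.
    elim: (m i) => [|j IHj]; first by rewrite expr0.
    rewrite exprS; apply: subf => //; exists (i == b)%:R; rewrite sX.
    by case: eqP => [->|_]; rewrite ?subrr ?mulr0 // opprB addrC subrK mulr1.
  exists (c%:MP * l + k1); rewrite -mul_mpolyC sD sM sC mulrDr mulrCA -el -e1; ring.
- exact: (nzd_var2 upV pq (free_wt Vp)).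
Qed.

End Substitution.

(** * Socle monomials of matroidal powers *)

Section MatroidWitnesses.

Variables (n : nat) (bs : 'I_n -> 'I_n -> 'I_n -> bool).
Hypothesis M : rank3_matroid bs.
Implicit Types (x y z v w p q a b c : 'I_n) (m : 'X_{1..n}) (t : nat).
Local Notation npar := (npar bs).
Local Notation par := (par bs).
Local Notation lin := (lin bs).
Local Notation cond := (cond bs).

Let rot x y z : bs x y z = bs y z x. Proof. by rewrite (bsC12 M) (bsC23 M). Qed.
Let rot2 x y z : bs x y z = bs z x y. Proof. by rewrite (bsC23 M) (bsC12 M). Qed.
Let C13 x y z : bs x y z = bs z y x. Proof. by rewrite rot (bsC12 M). Qed.

Lemma bs_linF x y z : bs x y z = ~~ lin x y z.
Proof. by rewrite /lin negbK. Qed.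

Lemma nparN x y : ~~ npar x y = par x y.
Proof. exact: negbK. Qed.

Lemma nparxx x : npar x x = false.
Proof. by apply/negbTE; rewrite nparN (par_refl M). Qed.

Lemma npar_split x y p : npar x y -> npar p x || npar p y.
Proof.
apply: contraLR; rewrite negb_or => /andP[/negbNE px /negbNE py].
by rewrite nparN -(par_par M _ px).
Qed.

Lemma bs_split x y z p q : bs x y z -> npar p q -> [|| bs p q x, bs p q y | bs p q z].
Proof.
move=> b npq; apply: contraTT b; rewrite !negb_or => /and3P[].
exact: npar_lin.
Qed.

Lemma bs_npar2 x y z p : bs x y z -> npar p x + npar p y + npar p z >= 2.
Proof.
case/(bs_npar M) => /(npar_split p) + /(npar_split p) + /(npar_split p).
by case: (npar p x) (npar p y) (npar p z) => [] [] [].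
Qed.

Lemma npar_par x y z : par x y -> npar x z = npar y z.
Proof. by move=> pxy; rewrite -[LHS]negbK -[RHS]negbK !nparN (par_par M _ pxy). Qed.

Lemma upc_cond t : upc (cond t).
Proof.
move=> m m' /condP[h1 h2 h3]; apply/condP; split=> [|x|x y nxy].
- by rewrite mdegD; apply: leq_trans h1 (leq_addr _ _).
- by rewrite wtD; apply: leq_trans (h2 x) (leq_addr _ _).
- by rewrite wtD; apply: leq_trans (h3 x y nxy) (leq_addr _ _).
Qed.

(** An exponent [3 * t] alone fulfils every inequality in which it occurs, so raising it further
    changes nothing. *)
Lemma saturated_cond t : saturated (cond t) (3 * t).
Proof.
move=> m i mi /condP[h1 h2 h3]; apply/condP; split=> [|x|x y nxy].
- by rewrite -wtT; apply: leq_trans mi (wt_ge _ _).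
- have := h2 x; rewrite wtD wtU; case nxi: (npar x i); last by rewrite addn0.
  by have := wt_ge m nxi; lia.
- have := h3 x y nxy; rewrite wtD wtU; case bi: (bs x y i); last by rewrite addn0.
  by have := wt_ge m bi; lia.
Qed.

Lemma condD s t m1 m2 : cond s m1 -> cond t m2 -> cond (s + t) (m1 + m2)%MM.
Proof.
move=> /condP[a1 a2 a3] /condP[b1 b2 b3]; apply/condP; split=> [|x|x y nxy].
- by rewrite mdegD; lia.
- by rewrite wtD; have := a2 x; have := b2 x; lia.
- by rewrite wtD; have := a3 x y nxy; have := b3 x y nxy; lia.
Qed.

Lemma cond_basis x y z : bs x y z -> cond 1 (U_(x) + U_(y) + U_(z))%MM.
Proof.
move=> b; apply/condP; split=> [|p|p q npq]; rewrite ?mdegD ?mdeg1 // !wtD !wtU.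
  exact: bs_npar2.
by have := bs_split b npq; case: (bs p q x) (bs p q y) (bs p q z) => [] [] [].
Qed.

Lemma cond1_basis m : cond 1 m ->
  exists x y z m', bs x y z /\ m = (m' + (U_(x) + U_(y) + U_(z)))%MM.
Proof. by case/(cond_split M) => x [y [z [m' [b -> _]]]]; exists x, y, z, m'. Qed.

(** Here [bs x a b] says that [a] and [b] span different lines with [x]. *)
Definition three_lines x := exists a b c, [/\ bs x a b, bs x a c & bs x b c].

Lemma wit_line t x y : 0 < t -> npar x y -> exists u, witness (cond t) (3 * t) (bs x y) u.
Proof.
move=> t0 nxy; have [z b] := nparP _ _ _ nxy.
(* The exponent of [z] is one short of the inequality of this line; any other flat misses [x] or
   [y], whose exponent [3 * t] suffices. *)
pose u : 'X_{1..n} := [multinom (if bs x y i then if i == z then t.-1 else 0 else 3 * t) | i < n].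
have u_off i : ~~ bs x y i -> u i = 3 * t by move=> /negPf bi; rewrite mnmE bi.
have wu : wt (bs x y) u = t.-1.
  rewrite /wt (bigD1 z) //= big1 => [|i /andP[bi /negPf iz]]; rewrite mnmE ?b ?eqxx ?addn0 //.
  by rewrite bi iz.
have ux : u x = 3 * t by apply/u_off/(linxyx M).
have uy : u y = 3 * t by apply/u_off/(linxyy M).
exists u; split=> [|i bi|i /u_off -> //].
  by apply/negP => /condP[_ _ /(_ x y nxy)]; lia.
apply/condP; split=> [|p|p q npq].
- by rewrite mdegD -wtT; have := wt_ge u (isT : predT x); lia.
- by rewrite wtD; have /orP[np|np] := npar_split p nxy; have := wt_ge u np; lia.
- rewrite wtD wtU; have [lx|bx] := boolP (lin p q x); last first.
    by have := wt_ge u (negbNE bx); lia.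
  have [ly|by_] := boolP (lin p q y); last first.
    by have := wt_ge u (negbNE by_); lia.
  have e j : bs p q j = bs x y j by rewrite !bs_linF (lin_eq M _ npq nxy).
  by rewrite (wt_ext _ e) e wu bi; lia.
Qed.

Lemma wit_point t x : 1 < t -> three_lines x -> exists u, witness (cond t) (3 * t) (npar x) u.
Proof.
move=> t1 [a [b [c [bab bac bbc]]]].
have [nxa nxb nab] := bs_npar M bab; have [_ nxc nac] := bs_npar M bac.
have [_ _ nbc] := bs_npar M bbc.
(* The total [2 * t - 1] is one short for the point [x]. A line through [x] misses at least two of
   [a], [b], [c], which weigh at least [t] because [t > 1]. *)
pose v : 'X_{1..n} := (U_(a) *+ t.-1 + U_(b) *+ t.-1 + U_(c))%MM.
pose u : 'X_{1..n} := [multinom (if npar x i then v i else 3 * t) | i < n].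
have uv (A : pred 'I_n) : (forall i, A i -> npar x i) -> wt A u = t.-1 * A a + t.-1 * A b + A c.
  move=> An; rewrite -!wtU -!wtMn -!wtD; apply: eq_bigr => i Ai.
  by rewrite mnmE An.
have u_off i : ~~ npar x i -> u i = 3 * t by move=> /negPf bi; rewrite mnmE bi.
have ux : u x = 3 * t by rewrite u_off // nparN (par_refl M).
have wx : wt (npar x) u = t.-1 + t.-1 + 1 by rewrite uv // nxa nxb nxc; clear; lia.
exists u; split=> [|i ni|i /u_off -> //].
  by apply/negP => /condP[_ /(_ x) + _]; clear -wx t1; lia.
apply/condP; split=> [|p|p q npq].
- by rewrite mdegD -wtT; have := wt_ge u (isT : predT x); clear -ux; lia.
- rewrite wtD wtU; have [npx|/negbNE ppx] := boolP (npar p x).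
    by have := wt_ge u npx; clear -ux; lia.
  by rewrite (wt_ext _ (fun j => npar_par j ppx)) (npar_par _ ppx) ni wx; clear -t1; lia.
- rewrite wtD; have [lx|bx] := boolP (lin p q x); last first.
    by have := wt_ge u (negbNE bx); clear -ux; lia.
  have [y nxy e] := lin_through M npq lx.
  have e' j : bs p q j = bs x y j by rewrite !bs_linF e.
  rewrite (wt_ext _ e') uv => [|j]; last by case/(bs_npar M).
  have sp d d' : bs x d d' -> bs x y d || bs x y d'.
    by move=> bd; have := bs_split bd nxy; rewrite bs_linF (linxyx M).
  move: (sp _ _ bab) (sp _ _ bac) (sp _ _ bbc).
  by case: (bs x y a) (bs x y b) (bs x y c) => [] [] [] //= _ _ _; clear -t1; lia.
Qed.

Lemma wit_class t V m : 0 < t -> witness (cond t) (3 * t) V m ->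
  [\/ exists x y, npar x y /\ V =1 bs x y,
      1 < t /\ (exists x, three_lines x /\ V =1 npar x) | V =1 predT].
Proof.
move=> t0 [nC CV big].
have [lt3|ge3] := ltnP (mdeg m) (3 * t).
  constructor 3 => i /=; case Vi: (V i) => //; move: lt3; rewrite ltnNge => /negP[].
  by apply: leq_trans (big i (negbT Vi)) _; rewrite -wtT; apply: wt_ge.
(* If every variable in [V] repairs a violated inequality on [A], then [V] lies in [A]. A variable
   of [A] outside [V] would have exponent [3 * t], and nothing would be violated. *)
have VE (A : pred 'I_n) k : wt A m < k -> k <= 3 * t ->
    (forall i, V i -> k <= wt A (m + U_(i))%MM) -> V =1 A.
  move=> lt_k k3 geV i; apply/idP/idP => [/geV|Ai].
    by rewrite wtD wtU; case: (A i) => //; lia.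
  by apply: contraLR lt_k => /big le_i; have := wt_ge m Ai; lia.
have [/existsP[x lt_x]|/existsPn ge_x] := boolP [exists x, wt (npar x) m < 2 * t]; last first.
  have [/existsP[x /existsP[y /andP[nxy lt_x]]]|ge_l] :=
      boolP [exists x, exists y, npar x y && (wt (bs x y) m < t)].
    constructor 1; exists x, y; split=> //; apply: VE lt_x _ _ => [|i /CV/condP[_ _]]; first lia.
    by apply.
  case/negP: nC; apply/condP; split=> // [x|x y nxy]; first by rewrite leqNgt.
  by move/existsPn/(_ x)/existsPn/(_ y): ge_l; rewrite nxy -leqNgt.
constructor 2; have VEx : V =1 npar x.
  by apply: VE lt_x _ _ => [|i /CV/condP[_ + _]]; [lia | apply].
have ge_l y : npar x y -> t <= wt (bs x y) m.
  move=> nxy; have := nxy; rewrite -VEx => /CV/condP[_ _ /(_ x y nxy)].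
  by rewrite wtD wtU bs_linF (linxyy M) addn0.
have [y0 [z0 b0]] := bs_loopless M x; have [nxy0 _ _] := bs_npar M b0.
have wx : wt (npar x) m = (2 * t).-1.
  have := nxy0; rewrite -VEx => /CV/condP[_ /(_ x) + _]; rewrite wtD wtU nxy0; lia.
(* Since [npar x] weighs [2 * t - 1] and the complement of each line through [x] at least [t], each
   such line carries at most [t - 1] outside [par x]. Two lines cannot exhaust the weight, and
   [t > 1]. *)
have cl y : npar x y -> wt (predI (npar x) (lin x y)) m + wt (bs x y) m <= wt (npar x) m.
  move=> nxy; apply: wt_disj => i; first by case/andP.
    by case/(bs_npar M).
  by case/andP.
have [y1 nxy1 my1] : exists2 y, npar x y & 0 < m y by apply: wt_gt0; lia.
have [y2 b2 my2] : exists2 y, bs x y1 y & 0 < m y.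
  by apply: wt_gt0; apply: leq_trans t0 (ge_l _ nxy1).
have [_ nxy2 _] := bs_npar M b2.
have y1_in : predI (npar x) (lin x y1) y1 by rewrite /= nxy1 (linxyy M).
have := cl _ nxy1; have := cl _ nxy2; have := ge_l _ nxy1; have := ge_l _ nxy2.
have := wt_ge m y1_in => w1 g2 g1 c2 c1; split; first by lia.
exists x; split=> //.
have [y3 /andP[b3 b3'] _] : exists2 y, predI (bs x y1) (bs x y2) y & 0 < m y.
  apply: wt_gt0; suff : wt (npar x) m <= wt (predI (npar x) (lin x y1)) m +
      (wt (predI (npar x) (lin x y2)) m + wt (predI (bs x y1) (bs x y2)) m) by lia.
  apply: leq_trans (leq_add (leqnn _) (wt_cover (D := predU (predI (npar x) (lin x y2))
    (predI (bs x y1) (bs x y2))) _)); last by move=> i _.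
  apply: wt_cover => i _ /= ->; rewrite /lin /=.
  by case: (bs x y1 i) (bs x y2 i) => [] [].
by exists y1, y2, y3.
Qed.

(* [u] lies outside [I^t], but all its multiples by variables lie in [I^t]. *)
Definition socle t := exists u, [/\ mdeg u + 1 = 3 * t,
  forall x, 2 * t <= wt (npar x) u & forall x y, npar x y -> t <= wt (bs x y) u].

(** A variable lying in a flat does not change the weight of its complement. So [u] satisfies all
    point and line inequalities itself, and only the degree fails, by one. *)
Lemma socle_witness x0 t : socle t <-> exists u, witness (cond t) (3 * t) predT u.
Proof.
split=> [[u [du hp hl]]|[u [nC C _]]]; exists u.
  split=> // [|i _]; first by apply/negP => /condP[]; lia.
  apply/condP; split=> [|x|x y nxy]; first by rewrite mdegD mdeg1; lia.
    by rewrite wtD; apply: leq_trans (hp x) (leq_addr _ _).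
  by rewrite wtD; apply: leq_trans (hl x y nxy) (leq_addr _ _).
have hp x : 2 * t <= wt (npar x) u.
  by have /condP[_ /(_ x) + _] := C x isT; rewrite wtD wtU nparxx addn0.
have hl x y : npar x y -> t <= wt (bs x y) u.
  move=> nxy; have /condP[_ _ /(_ x y nxy)] := C x isT.
  by rewrite wtD wtU [bs _ _ _]bs_linF (linxyx M) addn0.
split=> //; have /condP[+ _ _] := C x0 isT; rewrite mdegD mdeg1.
have : ~~ (3 * t <= mdeg u) by apply: contra nC => h; apply/condP.
lia.
Qed.

Lemma socleS x0 t : socle t -> socle t.+1.
Proof.
have [y [z b]] := bs_loopless M x0; have /condP[_ b2 b3] := cond_basis b.
move=> [u [du hp hl]]; exists (u + (U_(x0) + U_(y) + U_(z)))%MM; split=> [|p|p q npq].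
- by rewrite !mdegD !mdeg1; lia.
- by rewrite wtD; have := hp p; have := b2 p; lia.
- by rewrite wtD; have := hl p q npq; have := b3 p q npq; lia.
Qed.

Lemma socle_leq x0 s t : s <= t -> socle s -> socle t.
Proof.
move=> le_st ss; elim: t le_st => [|t IHt]; first by rewrite leqn0 => /eqP <-.
by rewrite leq_eqVlt => /orP[/eqP <- //|/IHt/(socleS x0)].
Qed.

Lemma socle_ge2 t : socle t -> 2 <= t.
Proof.
case: t => [|[|t]] // [u [du hp _]]; first by lia.
have [i _ ui] : exists2 i, predT i & 0 < u i by apply: wt_gt0; rewrite wtT; lia.
suff : wt (npar i) u + wt (pred1 i) u <= mdeg u.
  by have := wt_ge u (eqxx i : pred1 i i); have := hp i; lia.
rewrite -wtT; apply: wt_disj => // j nij; apply: contraL nij => /eqP ->.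
by rewrite nparN (par_refl M).
Qed.

(** The square of the product has degree 8, one less than [3 * 3]. A point contains at most one of
    the four and a line at most two, so the complements weigh at least 6 and 4. *)
Lemma socle_general x y z w : bs x y z -> bs x y w -> bs x z w -> bs y z w -> socle 3.
Proof.
move=> b1 b2 b3 b4; exists ((U_(x) + U_(y) + U_(z) + U_(w)) *+ 2)%MM; split=> [|p|p q npq].
- by rewrite mdegMn !mdegD !mdeg1.
- rewrite wtMn !wtD !wtU; have := bs_npar2 p b1; have := bs_npar2 p b2.
  by have := bs_npar2 p b3; have := bs_npar2 p b4; lia.
- rewrite wtMn !wtD !wtU; have := bs_split b1 npq; have := bs_split b2 npq.
  by have := bs_split b3 npq; have := bs_split b4 npq; lia.
Qed.

(* Up to parallel elements, the matroid consists of [q] and of the points of one line. *)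
Definition pencil q := forall u v w, npar q u -> npar q v -> npar q w -> lin u v w.

Definition four_general := exists x y z w, [/\ bs x y z, bs x y w, bs x z w & bs y z w].

Lemma lin_meet x y z e : bs x y z -> npar x e -> lin x y e -> bs x z e.
Proof.
move=> b nxe l; have [nxy nxz _] := bs_npar M b; apply: contraLR b => l'.
have lx := linxyx M; rewrite -[~~ _]/(lin x y z).
by rewrite (lin_inter M nxy nxz nxe) // (linxyy M).
Qed.

Definition inner x y := exists e, [/\ lin x y e, npar x e & npar y e].

Lemma inner_sym x y : inner x y -> inner y x.
Proof. by case=> e [l nx ny]; exists e; split; rewrite // /lin (bsC12 M). Qed.

(** With [e] a third point on the side [x y] and [f] one on the side [x z], the points [y], [z],
    [e], [f] are in general position. *)
Lemma inner2_four_general x y z : bs x y z -> inner x y -> inner x z -> four_general.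
Proof.
move=> b [e [le nxe nye]] [f [lf nxf nzf]]; have [nxy nxz nyz] := bs_npar M b.
have b1 : bs x z e by apply: lin_meet b nxe le.
have b' : bs x z y by rewrite (bsC23 M).
have b2 : bs x y f by apply: lin_meet b' nxf lf.
exists y, z, e, f; split.
- by apply: (@lin_meet y x z); rewrite /lin 1?(bsC12 M).
- rewrite (bsC12 M); apply: (@lin_meet z x y) => //; first by rewrite -rot2.
  by rewrite /lin (bsC12 M).
- by rewrite bs_linF (lin_eq M _ nxy nye) -?bs_linF // (linxyy M).
- by rewrite (bsC23 M) bs_linF (lin_eq M _ nxz nzf) -?bs_linF // (linxyy M).
Qed.

(** In a triangle none of whose vertices is the apex of a pencil, each vertex has another point off
    the opposite side. Either it is general with respect to the triangle, or it makes a side at that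
    vertex [inner]. One side cannot serve all three vertices, and two sides share a vertex. *)
Lemma general_or_pencil x0 : four_general \/ exists q, pencil q.
Proof.
have [hq|nq] := classic four_general; [by left | right].
have [y0 [z0 b0]] := bs_loopless M x0.
have inn x y z : bs x y z -> ~ pencil z -> inner x z \/ inner y z.
  move=> b np; have [nxy _ _] := bs_npar M b.
  have [e be nze] : exists2 e, bs x y e & npar z e.
    apply: NNPP => no_e; apply: np => u v w nu nv nw.
    apply/negP => /bs_split/(_ nxy)/or3P[]bi; apply: no_e; [exists u|exists v|exists w]; done.
  have [_ nxe nye] := bs_npar M be.
  have [le|b1] := boolP (lin x z e); first by left; exists e.
  have [le|b2] := boolP (lin y z e); first by right; exists e.
  by case: nq; exists x, y, z, e; split=> //; apply/negPn.
have [b1 b2] : bs x0 z0 y0 /\ bs y0 z0 x0.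
  by split; [rewrite (bsC23 M) | rewrite -rot].
apply: NNPP => np; have {}np q : ~ pencil q by move=> pq; apply: np; exists q.
case: (inn _ _ _ b0 (np _)); case: (inn _ _ _ b1 (np _)); case: (inn _ _ _ b2 (np _)) => i1 i2 i3;
  apply: nq; (first
  [ by apply: (inner2_four_general b0); auto using inner_sym
  | by apply: (@inner2_four_general y0 x0 z0); [rewrite (bsC12 M) | |]; auto using inner_sym
  | by apply: (@inner2_four_general z0 x0 y0); [rewrite rot | |]; auto using inner_sym ]).
Qed.

Section Pencil.

Variable q : 'I_n.
Hypothesis Hq : pencil q.

Lemma pencil_basis : exists a b, bs q a b.
Proof. exact: bs_loopless. Qed.

Lemma pencil_bs a b : npar q a -> npar q b -> npar a b -> bs q a b.
Proof.
move=> nqa nqb /nparP[z b1]; have [nqz|/negbNE pqz] := boolP (npar q z).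
  by case/negP: (Hq nqa nqb nqz).
by rewrite (par_bs M _ _ pqz) rot.
Qed.

Lemma bs_pencil a b i : bs q a b -> bs a b i = par q i.
Proof.
move=> b1; have [nqa nqb nab] := bs_npar M b1.
apply/idP/idP => [b2|pqi]; last by rewrite rot2 -(par_bs M _ _ pqi).
by apply: contraTT b2 => nqi; apply: Hq.
Qed.

Lemma cond_pencil t m : cond t m <->
  [/\ t <= wt (par q) m, 2 * t <= wt (npar q) m &
      forall y, npar q y -> t <= wt (bs q y) m].
Proof.
have [a [b b1]] := pencil_basis; have [nqa nqb nab] := bs_npar M b1.
split=> [/condP[h1 h2 h3]|[h1 h2 h3]]; [|apply/condP]; split=> //.
- by rewrite -(wt_ext _ (fun i => bs_pencil i b1)); apply: h3.
- by move=> y; apply: h3.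
- by have := wt_par bs q m; lia.
- move=> x; have [nqx|/negbNE pqx] := boolP (npar q x); last first.
    by rewrite -(wt_ext _ (fun i => npar_par i pqx)).
  suff : wt (par q) m + wt (bs q x) m <= wt (npar x) m by have := h3 x nqx; lia.
  apply: wt_disj => i; last by move=> pqi; rewrite bs_linF -(par_lin3 M _ _ pqi) (linxyx M).
    by move=> pqi; rewrite (npar_sym M) -(npar_par _ pqi).
  by case/(bs_npar M).
- move=> x y nxy; have [lq|bq] := boolP (lin x y q).
    have [u nqu e] := lin_through M nxy lq.
    rewrite (wt_ext (B := bs q u)) => [|i]; first exact: h3.
    by rewrite !bs_linF e.
  apply: leq_trans h1 (wt_sub _ _) => i pqi.
  by rewrite bs_linF -(par_lin3 M _ _ pqi).
Qed.

Lemma pencil_not_socle t : ~ socle t.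
Proof.
move=> [u [du hp hl]]; have [a [b b1]] := pencil_basis; have [_ _ nab] := bs_npar M b1.
have := hp q; have := hl _ _ nab; rewrite (wt_ext _ (fun i => bs_pencil i b1)).
by have := wt_par bs q u; lia.
Qed.

(** A basis avoiding [q] exists, as [q] is no coloop, and it cannot lie on the line alone. *)
Lemma pencil_parallel : exists2 q', par q q' & q' != q.
Proof.
have [u [v [w [b nu nv nw]]]] := bs_coloopless M q.
have [pqu|nqu] := boolP (par q u); first by exists u.
have [pqv|nqv] := boolP (par q v); first by exists v.
have [pqw|nqw] := boolP (par q w); first by exists w.
by case/negP: (Hq nqu nqv nqw).
Qed.

Lemma pencil_two_classes a b i : ~ three_lines q -> bs q a b -> npar q i -> par a i || par b i.
Proof.
move=> n3 b1 nqi; apply: contraT; rewrite negb_or => /andP[nai nbi].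
have [nqa nqb _] := bs_npar M b1.
by case: n3; exists a, b, i; split=> //; apply: pencil_bs.
Qed.

Lemma pencil_two_bs a b i : ~ three_lines q -> bs q a b -> bs q a i = par b i.
Proof.
move=> n3 b1; apply/idP/idP => [b2|pbi].
  have [_ nqi nai] := bs_npar M b2.
  by have := pencil_two_classes n3 b1 nqi; rewrite (negPf nai).
by rewrite bs_linF -(par_lin3 M _ _ pbi) -bs_linF.
Qed.

Lemma pencil_no_three x : ~ three_lines q -> ~ three_lines x.
Proof.
move=> n3 [a [b [c [b1 b2 b3]]]]; have [nqx|/negbNE pqx] := boolP (npar q x); last first.
  by case: n3; exists a, b, c; split; rewrite (par_bs M _ _ pqx).
have [_ _ nab] := bs_npar M b1; have [_ _ nac] := bs_npar M b2; have [_ _ nbc] := bs_npar M b3.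
have no d d' : bs x d d' -> ~~ (npar q d && npar q d').
  by move=> bd; apply: contraL bd => /andP[nd nd']; apply: Hq.
move: (no _ _ b1) (no _ _ b2) (no _ _ b3).
move: (npar_split q nab) (npar_split q nac) (npar_split q nbc).
by case: (npar q a) (npar q b) (npar q c) => [] [] [].
Qed.

(* The complements of the lines, which index the primary components without embedded primes. *)
Definition pencil_comp y : pred 'I_n := if par q y then par q else bs q y.

(** The inequality of the point [q] must follow from the lines. For [t = 1], an [i] off [q] in the
    support adds one to the complement of the line [q i]. With only two lines through [q], their
    complements are disjoint inside [npar q]. *)
Lemma cond_comp t m : 0 < t -> t = 1 \/ ~ three_lines q ->
  cond t m = [forall y, t <= wt (pencil_comp y) m].
Proof.
move=> t0 tq; apply/idP/forallP => [/cond_pencil[h1 h2 h3] y|h].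
  by rewrite /pencil_comp; case: ifP => // /negbT; apply: h3.
have [a [b b1]] := pencil_basis; have [nqa nqb nab] := bs_npar M b1.
have h1 : t <= wt (par q) m by have := h q; rewrite /pencil_comp (par_refl M).
have h3 y : npar q y -> t <= wt (bs q y) m.
  by move=> /negPf nqy; have := h y; rewrite /pencil_comp nqy.
apply/cond_pencil; split=> //; case: tq => [t1|n3].
  have [i bi mi] : exists2 i, bs q a i & 0 < m i by apply: wt_gt0; apply: leq_trans t0 (h3 _ nqa).
  have [_ nqi _] := bs_npar M bi.
  suff : wt (bs q i) m + wt (pred1 i) m <= wt (npar q) m.
    by have := wt_ge m (eqxx i : pred1 i i); have := h3 i nqi; lia.
  apply: wt_disj => j; first by case/(bs_npar M).
    by move/eqP ->.
  by move=> bj; apply: contraL bj => /eqP ->; apply: linxyy.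
have b2 : bs q b a by rewrite (bsC23 M).
suff : wt (bs q a) m + wt (bs q b) m <= wt (npar q) m by have := h3 a nqa; have := h3 b nqb; lia.
apply: wt_disj => j; try by case/(bs_npar M).
rewrite (pencil_two_bs _ n3 b1) (pencil_two_bs _ n3 b2) => pbj.
by rewrite /= par_sym // -(par_par M _ pbj) par_sym.
Qed.

End Pencil.

End MatroidWitnesses.

(** * Depth of matroidal powers *)

Lemma pred_ext (T : Type) (A B : T -> Prop) : (forall x, A x <-> B x) -> A = B.
Proof.
by move=> AB; apply: functional_extensionality => x; apply: propositional_extensionality.
Qed.

Section MonomialDepth.

Local Open Scope ring_scope.

Variables (K : fieldType) (n : nat).
Local Notation R := {mpoly K[n]}.
Local Notation X := (fun i => 'X_i : R).
Implicit Types (C D : pred 'X_{1..n}) (m u : 'X_{1..n}) (f g : R).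

Lemma eq_nm C D : C =1 D -> nm C = nm D :> (R -> Prop).
Proof. by move=> CD; apply: pred_ext => f; apply: nm_ext. Qed.

Lemma capI_nm C D : capI (nm C) (nm D) = nm (fun m => C m && D m) :> (R -> Prop).
Proof. by apply: pred_ext => f; apply: nm_capI. Qed.

Lemma sum_var_irrelevant : irrelevant_ideal (\sum_i 'X_i : R).
Proof. by apply: ideal_sum => [|i _]; [apply: gen_ideal_ideal | apply: var_ideal]. Qed.

Lemma nm_proper C m : upc C -> ~~ C m -> ~~ C 0%MM.
Proof. by move=> upC; apply: contra => C0; rewrite -[m]add0m; apply: upC. Qed.

Lemma nm_regular_seq C (s : seq R) : upc C -> ~~ C 0%MM ->
  (forall f, f \in s -> irrelevant_ideal f) -> (size s <= 2)%N ->
  ((0 < size s)%N -> nzd (nm C) s`_0) ->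
  ((1 < size s)%N -> nzd (adj (nm C) s`_0) s`_1) -> regular_seq (nm C) s.
Proof.
move=> upC nC0 ms; apply: (regular_seq_intro (N := nm (fun m => 0 < wt predT m)%N)).
- exact: nm_ideal.
- exact/nm_ideal/upc_wt.
- by rewrite -mpolyX0 => /nmX; rewrite wtT mdeg0.
- move=> f; apply: nm_imp => m; rewrite wtT lt0n mdeg_eq0; apply: contraL.
  by move/eqP->.
- by move=> f /ms/irrelevant_nm.
Qed.

Lemma socle_depth0 C u : upc C -> ~~ C u -> (forall i, C (u + U_(i))%MM) ->
  is_depth (nm C : R -> Prop) 0.
Proof.
move=> upC nCu Cu; split=> [|s ms reg].
  by exists [::]; split=> //; apply: nm_regular_seq (nm_proper upC nCu) _ _ _ _.
rewrite leqNgt; apply/negP => lt0.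
have [/(_ lt0) nz _ _] := regular_seq_nzd (nm_ideal K upC) reg.
by apply: socle_not_nzd nCu Cu upC (ms _ _) nz; apply: mem_nth.
Qed.

Lemma depth_uniq (J : R -> Prop) d e : is_depth J d -> is_depth J e -> d = e.
Proof.
move=> [[s [<- ms rs]] hd] [[r [<- mr rr]] he].
by apply/eqP; rewrite eqn_leq he ?hd.
Qed.

Lemma nzd_all (T : eqType) (s : seq T) (D : T -> pred 'X_{1..n}) f :
  (forall i, nzd (nm (D i)) f) -> nzd (nm (fun m => all (fun i => D i m) s)) f.
Proof.
move=> nz g Dfg m mg; apply/allP => i si; apply: (nz i) mg => u /Dfg/allP; exact.
Qed.

(** Components are intersected one by one. Sums of monomial ideals distribute over intersections, so
    regularity of [f] on pairwise sums is enough. *)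
Lemma nzd_adj_all (T : eqType) (s : seq T) (D : T -> pred 'X_{1..n}) f g :
  (forall i, upc (D i)) -> (forall i j, nzd (nm (fun m => D i m || D j m)) f) ->
  (forall i, nzd (adj (nm (D i)) f) g) ->
  nzd (adj (nm (fun m => all (fun i => D i m) s)) f) g.
Proof.
move=> upD nzf nzg; elim: s => [|i s IHs] /=.
  by move=> h _; exists 0; rewrite mulr0 subr0 => m.
have upA : upc (fun m => all (fun i => D i m) s).
  by move=> m m' /allP a; apply/allP => j /a; apply: upD.
rewrite -capI_nm; have sp := nm_sum_split K (upD i) upA.
apply: nzd_adj_cap sp _ (nzg i) IHs; try exact: nm_ideal.
rewrite (@eq_nm _ (fun m => all (fun j => D i m || D j m) s)); first exact: nzd_all.
by move=> m /=; clear; elim: s => [|j s IHs] /=; rewrite ?orbT // -IHs orb_andr.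
Qed.

End MonomialDepth.

Section MatroidDepth.

Local Open Scope ring_scope.

Variables (K : fieldType) (n : nat) (bs : 'I_n -> 'I_n -> 'I_n -> bool).
Hypothesis M : rank3_matroid bs.
Local Notation R := {mpoly K[n]}.
Local Notation X := (fun i => 'X_i : R).
Local Notation npar := (npar bs).
Local Notation par := (par bs).
Local Notation cond := (cond bs).
Implicit Types (x y z p q a b c : 'I_n) (m : 'X_{1..n}) (t : nat).

Definition pow_nm t : R -> Prop := nm (cond t).

Lemma pow_nm_ideal t : is_ideal (pow_nm t).
Proof. exact/nm_ideal/upc_cond. Qed.

Lemma cond_0 t : (0 < t)%N -> ~~ cond t 0%MM.
Proof. by move=> t0; apply/negP => /condP[]; rewrite mdeg0; lia. Qed.

Lemma pow_depth0 x0 t : socle bs t -> is_depth (pow_nm t) 0.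
Proof.
move/(socle_witness M x0) => [u [nCu Cu _]].
by apply: socle_depth0 nCu _ => [|i]; [apply: upc_cond | apply: Cu].
Qed.

Lemma nzd_pow_sum x0 t : (0 < t)%N -> ~ socle bs t -> nzd (pow_nm t) (\sum_i 'X_i).
Proof.
move=> t0 ns g Ng m mg.
have hp x : (2 * t <= wt (npar x) m)%N.
  have nz : nzd (nm (fun m => 2 * t <= wt (npar x) m)%N) (\sum_i 'X_i : R).
    apply: (@nzd_sum_var _ _ _ x); first exact: upc_wt.
    by apply: free_wt; rewrite (nparxx M).
  by apply: nz mg => u /Ng/condP[].
have hl x y : npar x y -> (t <= wt (bs x y) m)%N.
  move=> nxy; have nz : nzd (nm (fun m => t <= wt (bs x y) m)%N) (\sum_i 'X_i : R).
    apply: (@nzd_sum_var _ _ _ x); first exact: upc_wt.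
    by apply/free_wt/(linxyx M).
  by apply: nz mg => u /Ng/condP[_ _]; apply.
apply/condP; split=> //; rewrite leqNgt; apply/negP => lt3; apply: ns.
(* A monomial meeting all point and line inequalities but of too small degree can be padded to
   degree [3 * t - 1], producing a socle element. *)
exists (m + U_(x0) *+ (3 * t - 1 - mdeg m))%MM; split=> [|x|x y nxy].
- by rewrite mdegD mdegMn mdeg1; lia.
- by rewrite wtD; apply: leq_trans (hp x) (leq_addr _ _).
- by rewrite wtD; apply: leq_trans (hl x y nxy) (leq_addr _ _).
Qed.

Lemma pow_regular_seq t (s : seq R) : (0 < t)%N ->
  (forall f, f \in s -> irrelevant_ideal f) -> (size s <= 2)%N ->
  ((0 < size s)%N -> nzd (pow_nm t) s`_0) ->
  ((1 < size s)%N -> nzd (adj (pow_nm t) s`_0) s`_1) -> regular_seq (pow_nm t) s.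
Proof. by move=> t0; apply: nm_regular_seq; [apply: upc_cond | apply: cond_0]. Qed.

Lemma regular_sum x0 t : (0 < t)%N -> ~ socle bs t -> regular_seq (pow_nm t) [:: \sum_i 'X_i].
Proof.
move=> t0 ns; apply: pow_regular_seq => //; last by move=> _; apply: nzd_pow_sum.
by move=> f /[!inE] /eqP ->; apply: sum_var_irrelevant.
Qed.

Lemma not_depth0 x0 t : (0 < t)%N -> ~ socle bs t -> ~ is_depth (pow_nm t) 0.
Proof.
move=> t0 ns [_ /(_ [:: \sum_i 'X_i])] d0.
have // : (1 <= 0)%N; apply: d0; last exact: regular_sum.
by move=> f /[!inE] /eqP ->; apply: sum_var_irrelevant.
Qed.

Section Pencil.

Variable q : 'I_n.
Hypothesis Hq : pencil bs q.
Let not_socle := pencil_not_socle M Hq.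

Lemma pow_comp t : (0 < t)%N -> t = 1%N \/ ~ three_lines bs q ->
  pow_nm t = nm (fun m => all (fun y => t <= wt (pencil_comp bs q y) m)%N (enum 'I_n)).
Proof.
move=> t0 tq; apply: eq_nm => m; rewrite (cond_comp M Hq m t0 tq).
apply/forallP/allP => [h y _|h y]; first exact: h.
by apply: h; rewrite mem_enum.
Qed.

Lemma pencil_two_seq t : (0 < t)%N -> t = 1%N \/ ~ three_lines bs q ->
  exists2 s : seq R, size s = 2 & (forall f, f \in s -> irrelevant_ideal f) /\
    regular_seq (pow_nm t) s.
Proof.
move=> t0 tq; have [p [b b1]] := pencil_basis M q.
have [nqp nqb npb] := bs_npar M b1; have [q' pqq' q'q] := pencil_parallel M Hq.
have npar_neq x y : npar x y -> x != y by apply: contraL => /eqP ->; rewrite (nparxx M).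
exists [:: \sum_i 'X_i; 'X_q + 'X_p] => //; split.
  move=> f /[!inE] /orP[/eqP ->|/eqP ->]; first exact: sum_var_irrelevant.
  have [_ mD _] := gen_ideal_ideal (fun f : R => exists i, f = 'X_i).
  by apply: mD; apply: var_ideal.
apply: pow_regular_seq => // [f|_|_].
- move=> /[!inE] /orP[/eqP ->|/eqP ->]; first exact: sum_var_irrelevant.
  have [_ mD _] := gen_ideal_ideal (fun f : R => exists i, f = 'X_i).
  by apply: mD; apply: var_ideal.
- exact: nzd_pow_sum.
rewrite /= (pow_comp t0 tq); apply: nzd_adj_all => [y|y y'|y].
- exact: upc_wt.
(* Each component is the complement of a line; [z] is a common point of the two lines. *)
- have [z hz hz'] : exists2 z, ~~ pencil_comp bs q y z & ~~ pencil_comp bs q y' z.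
    rewrite /pencil_comp; have [Py|Ny] := boolP (par q y); have [Py'|Ny'] := boolP (par q y').
    + by exists p.
    + by exists y' => //; apply/(linxyy M).
    + by exists y => //; apply/(linxyy M).
    + by exists q; apply/(linxyx M).
  apply: (@nzd_sum_var _ _ _ z); first by apply: upc_or; apply: upc_wt.
  by apply: free_or; apply: free_wt.
(* The substitution needs a point of the line besides the free one in the second form: [b] next to
   [p], or the parallel copy [q'] next to [q]. *)
- have [Py|Ny] := boolP (par q y).
    rewrite addrC; apply: (@nzd_adj_sum_var _ _ _ t b).
    + by rewrite eq_sym npar_neq.
    + exact: npar_neq.
    + exact: npar_neq.
    + by rewrite /pencil_comp Py.
    + by rewrite /pencil_comp Py.
  apply: (@nzd_adj_sum_var _ _ _ t q').
  + exact: npar_neq.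
  + by rewrite eq_sym.
  + by rewrite eq_sym npar_neq // -(npar_par M _ pqq').
  + rewrite /pencil_comp (negPf Ny) -[~~ _]/(lin bs _ _ _) -(par_lin3 M _ _ pqq'); exact: linxyx.
  + by rewrite /pencil_comp (negPf Ny); apply/(linxyx M).
Qed.

Lemma pencil_depth1 t : (1 < t)%N -> three_lines bs q -> is_depth (pow_nm t) 1.
Proof.
move=> t1 [a [b [c [bab bac bbc]]]]; have t0 := ltnW t1.
have [nqa nqb nab] := bs_npar M bab; have [_ nqc nac] := bs_npar M bac.
have [_ _ nbc] := bs_npar M bbc.
split=> [|s ms reg].
  exists [:: \sum_i 'X_i]; split=> //; last exact: regular_sum.
  by move=> f /[!inE] /eqP ->; apply: sum_var_irrelevant.
rewrite leqNgt; apply/negP => lt1.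
(* Both [Q] and [J] have a free variable, but their sum will have a socle. By Mayer-Vietoris [kos1]
   then fails for the intersection. *)
pose Q m := (t <= wt (par q) m)%N.
pose J m := (2 * t <= wt (npar q) m)%N &&
  all (fun y => ~~ npar q y || (t <= wt (bs q y) m)%N) (enum 'I_n).
have upQ : upc Q by apply: upc_wt.
have upJ : upc J.
  apply: upc_and; first exact: upc_wt.
  move=> m m' /allP h; apply/allP => y /h /orP[->//|h']; apply/orP; right.
  by rewrite wtD; apply: leq_trans h' (leq_addr _ _).
have QJ : pow_nm t = capI (nm Q) (nm J).
  rewrite capI_nm; apply: eq_nm => m; apply/idP/and3P => [/(cond_pencil M Hq)[h1 h2 h3]|[h1 h2 h3]].
    by split=> //; apply/allP => y _; case ny: (npar q y) => //=; apply: h3.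
  apply/(cond_pencil M Hq); split=> // y ny.
  by move/allP/(_ y): h3; rewrite mem_enum ny; apply.
have fQ : free_var Q a by apply: free_wt.
have fJ : free_var J q.
  apply: free_and; first by apply: free_wt; rewrite (nparxx M).
  move=> m /allP h; apply/allP => y /h; rewrite wtD wtU.
  by rewrite (negPf (linxyx M _ _)) addn0.
have := regular_seq_kos1 (pow_nm_ideal t) ms reg lt1; rewrite QJ.
move/(kos0_sum (nm_ideal K upQ) (nm_ideal K upJ) (nm_sum_split K upQ upJ)).
move=> /(_ (nm_kos0 upQ fQ) (nm_kos0 upJ fJ)).
(* One short of [Q] in the variable [q], and on [a], [b], [c] the exponents used for the prime of
   the point [q], one short of [J]. *)
pose u : 'X_{1..n} := (U_(q) *+ t.-1 + U_(a) *+ t.-1 + U_(b) *+ t.-1 + U_(c))%MM.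
have wu A : wt A u = (t.-1 * A q + t.-1 * A a + t.-1 * A b + A c)%N.
  by rewrite !wtD !wtMn !wtU.
have F y : npar y y = false by rewrite (nparxx M).
have P y : npar q y -> par q y = false by move/negbTE.
apply: (@socle_not_kos0 _ _ _ u) => [|i].
  rewrite negb_or negb_and /Q -!ltnNge !wu F nqa nqb nqc (par_refl M) !P //.
  by apply/andP; split; [|apply/orP; left]; clear -t1; lia.
have [pqi|nqi] := boolP (par q i); apply/orP; [left|right].
  by rewrite /Q wtD wu wtU (par_refl M) pqi !P //; clear -t1; lia.
apply/andP; split; first by rewrite wtD wu wtU F nqa nqb nqc [npar q i]nqi; clear -t1; lia.
apply/allP => y _; case nqy: (npar q y) => //=; rewrite wtD wu.
have sp d d' : bs q d d' -> bs q y d || bs q y d'.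
  by move=> bd; have := bs_split M bd nqy; rewrite (negPf (linxyx M _ _)).
move: (sp _ _ bab) (sp _ _ bac) (sp _ _ bbc).
case: (bs q y a) (bs q y b) (bs q y c) => [] [] [] //= _ _ _; clear -t1; lia.
Qed.

Lemma pencil_depth2 t : (0 < t)%N -> ~ three_lines bs q -> is_depth (pow_nm t) 2.
Proof.
move=> t0 n3; split=> [|s ms reg].
  by have [|s ss [ms reg]] := pencil_two_seq t0; [right | exists s].
rewrite leqNgt; apply/negP => lt2.
have [a [b b1]] := pencil_basis M q; have [q' pqq' q'q] := pencil_parallel M Hq.
have b2 : bs q b a by rewrite (bsC23 M).
have [nqa nqb nab] := bs_npar M b1.
pose Q m := (t <= wt (par q) m)%N; pose A m := (t <= wt (par a) m)%N.
pose B m := (t <= wt (par b) m)%N.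
have upQ : upc Q by apply: upc_wt.
have upA : upc A by apply: upc_wt.
have upB : upc B by apply: upc_wt.
have upAB := upc_and upA upB; have upQA := upc_or upQ upA; have upQB := upc_or upQ upB.
have wa m : wt (bs q a) m = wt (par b) m by apply: wt_ext => i; apply: pencil_two_bs.
have wb m : wt (bs q b) m = wt (par a) m by apply: wt_ext => i; apply: pencil_two_bs.
have bs_mid x y i : par x y -> bs q x i = bs q y i.
  by move=> pxy; rewrite (bsC12 M) (par_bs M _ _ pxy) (bsC12 M).
have QAB : pow_nm t = capI (nm Q) (nm (fun m => A m && B m)).
  rewrite capI_nm; apply: eq_nm => m; apply/idP/and3P => [/(cond_pencil M Hq)[h1 h2 h3]|[h1 h2 h3]].
    by split=> //; rewrite /A /B -?wa -?wb; apply: h3.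
  apply/(cond_pencil M Hq); split=> // [|y nqy].
    suff : (wt (par a) m + wt (par b) m <= wt (npar q) m)%N.
      by move: h2 h3; rewrite /A /B; lia.
    apply: wt_disj => i.
    + by move=> pai; rewrite (npar_sym M) -(npar_par M _ pai) (npar_sym M).
    + by move=> pbi; rewrite (npar_sym M) -(npar_par M _ pbi) (npar_sym M).
    + by move=> pai; rewrite (par_sym M) -(par_par M _ pai).
  have /orP[pay|pby] := pencil_two_classes M Hq n3 b1 nqy.
    by rewrite -(wt_ext _ (fun i => bs_mid _ _ i pay)) wa.
  by rewrite -(wt_ext _ (fun i => bs_mid _ _ i pby)) wb.
have nP x y : npar x y -> ~~ par x y by [].
have nbq : npar b q by rewrite (npar_sym M).
have naq : npar a q by rewrite (npar_sym M).
have nba : npar b a by rewrite (npar_sym M).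
have nq' x : npar x q -> npar x q'.
  by rewrite !(npar_sym M x) (npar_par M _ pqq').
have ab : a != b by apply: contraL nab => /eqP ->; rewrite (nparxx M).
have K1Q : kos1 X (nm Q) by apply: (nm_kos1 upQ ab); apply/free_wt/nP.
have K1AB : kos1 X (nm (fun m => A m && B m)).
  apply: (@nm_kos1 _ _ _ q q') => //; first by rewrite eq_sym.
    by apply: free_and; apply/free_wt/nP.
  by apply: free_and; apply/free_wt/nP/nq'.
have := regular_seq_kos2 (pow_nm_ideal t) ms reg lt2; rewrite QAB.
move/(kos1_sum (nm_ideal K upQ) (nm_ideal K upAB) (nm_sum_split K upQ upAB)).
move=> /(_ K1Q K1AB).
(* Distributivity presents [Q + (A n B)] as an intersection again, so Mayer-Vietoris applies a
   second time and descends to [kos0] of [Q + A + B]. *)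
rewrite (@eq_nm _ _ _ (fun m => (Q m || A m) && (Q m || B m))) => [|m]; last by rewrite orb_andr.
rewrite -capI_nm.
move/(kos0_sum (nm_ideal K upQA) (nm_ideal K upQB) (nm_sum_split K upQA upQB)).
have K0A : kos0 X (nm (fun m => Q m || A m)).
  by apply: (@nm_kos0 _ _ _ b upQA); apply: free_or; apply/free_wt/nP.
have K0B : kos0 X (nm (fun m => Q m || B m)).
  by apply: (@nm_kos0 _ _ _ a upQB); apply: free_or; apply/free_wt/nP.
move=> /(_ K0A K0B).
pose u : 'X_{1..n} := ((U_(q) + U_(a) + U_(b)) *+ t.-1)%MM.
have wu (V : pred 'I_n) : wt V u = (t.-1 * (V q + V a + V b))%N by rewrite wtMn !wtD !wtU.
have P x y : npar x y -> par x y = false by move/negbTE.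
have wQ : wt (par q) u = t.-1 by rewrite wu (par_refl M) !P // addn0 muln1.
have wA : wt (par a) u = t.-1 by rewrite wu (par_refl M) !P // addn0 add0n muln1.
have wB : wt (par b) u = t.-1 by rewrite wu (par_refl M) !P // !add0n muln1.
apply: (@socle_not_kos0 _ _ _ u) => [|i].
  by rewrite /Q /A /B wQ wA wB; clear -t0; lia.
rewrite /Q /A /B !wtD !wtU wQ wA wB.
have [pqi|nqi] := boolP (par q i); first by clear -t0; lia.
have /orP[->|->] := pencil_two_classes M Hq n3 b1 nqi; clear -t0; lia.
Qed.

End Pencil.

End MatroidDepth.

(** * The matroid of the ideal *)

Definition prop_bool (P : Prop) : bool := if excluded_middle_informative P then true else false.

Lemma prop_boolP (P : Prop) : reflect P (prop_bool P).
Proof. by rewrite /prop_bool; case: excluded_middle_informative => h; constructor. Qed.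

Section Bases.

Local Open Scope ring_scope.

Variables (K : fieldType) (n : nat) (I : {mpoly K[n]} -> Prop).
Hypotheses (I_matroidal : matroidal I 3) (I_full : full_supported I)
  (I_gcd : is_gcd 0%MM (mingens I)).
Local Notation R := {mpoly K[n]}.
Implicit Types (G : 'X_{1..n} -> Prop) (u v m : 'X_{1..n}) (f : R) (x y z : 'I_n).

Lemma mon_idealE G f :
  mon_ideal G f <-> forall m, m \in msupp f -> exists2 u, G u & (u <= m)%MM.
Proof.
pose C m := prop_bool (exists2 u, G u & (u <= m)%MM).
have upC : upc C.
  move=> m m' /prop_boolP[u Gu um]; apply/prop_boolP; exists u => //.
  by apply: lepm_trans um (lem_addr _ _).
suff -> : mon_ideal G f <-> nm C f by split=> h m /h /prop_boolP.
split.
  apply: gen_ideal_min => [|_ [u Gu ->]]; first exact: nm_ideal.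
  by apply/nmX/prop_boolP; exists u; rewrite ?lepm_refl.
apply: ideal_nm_min => [|m /prop_boolP[u Gu um]]; first exact: gen_ideal_ideal.
have [_ _ GM] := gen_ideal_ideal (fun f : R => exists2 u, G u & f = 'X_[u]).
rewrite -(submK um) mpolyXD.
by apply/GM/mem_gen; exists u.
Qed.

Lemma I_supp f : I f <-> forall m, m \in msupp f -> I 'X_[m].
Proof.
have [[[G GI _] _] _] := I_matroidal.
split=> [/GI/mon_idealE If m mf|h].
  by apply/GI/mon_idealE => u; rewrite msuppX inE => /eqP ->; apply: If.
apply/GI/mon_idealE => m /h/GI/mon_idealE; apply.
by rewrite msuppX inE.
Qed.

Lemma I_gen m : I 'X_[m] -> exists u, [/\ I 'X_[u], mdeg u = 3%N & (u <= m)%MM].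
Proof.
have [[[G GI G3] _] _] := I_matroidal.
move=> /GI/mon_idealE/(_ m); rewrite msuppX inE => /(_ (eqxx _))[u Gu um].
exists u; split=> //; last exact: G3.
by apply/GI/mem_gen; exists u.
Qed.

Lemma lem_mdeg u m : (u <= m)%MM -> (mdeg u <= mdeg m)%N.
Proof. by move=> /submK <-; rewrite mdegD leq_addl. Qed.

Lemma lem_mdeg_eq u m : (u <= m)%MM -> mdeg m = mdeg u -> m = u.
Proof.
move=> /submK <-; rewrite mdegD => /eqP; rewrite -{2}[mdeg u]add0n eqn_add2r mdeg_eq0.
by move/eqP ->; rewrite add0m.
Qed.

Lemma I_mdeg m : I 'X_[m] -> (3 <= mdeg m)%N.
Proof. by case/I_gen => u [_ <- /lem_mdeg]. Qed.

Lemma I_squarefree u i : I 'X_[u] -> mdeg u = 3%N -> (u i <= 1)%N.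
Proof.
have [_ [G GI G1]] := I_matroidal => Iu du.
have /GI/mon_idealE/(_ u) := Iu; rewrite msuppX inE => /(_ (eqxx _))[v Gv vu].
have Iv : I 'X_[v] by apply/GI/mem_gen; exists v.
have -> : u = v; last exact: G1.
by apply: (lem_mdeg_eq vu); apply/eqP; rewrite eqn_leq (lem_mdeg vu) du I_mdeg.
Qed.

(** No monomial of [I] has degree below 3, so one of degree 3 is divisible only by itself within [I]
    and belongs to every monomial generating set. *)
Lemma mingensE u : mingens I u <-> I 'X_[u] /\ mdeg u = 3%N.
Proof.
pose B v := I 'X_[v] /\ mdeg v = 3%N.
have genB : generates B I.
  move=> f; split=> [/I_supp If|/mon_idealE Bf].
    by apply/mon_idealE => m /If/I_gen[v [Iv dv vm]]; exists v.
  apply/I_supp => m /Bf[v [Iv _] vm].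
  have [[[G GI _] _] _] := I_matroidal; apply/GI.
  have [_ _ GM] := gen_ideal_ideal (fun f : R => exists2 u, G u & f = 'X_[u]).
  by rewrite -(submK vm) mpolyXD; apply/GM/GI.
have below G v : generates G I -> B v -> G v.
  move=> GI [Iv dv]; have /GI/mon_idealE/(_ v) := Iv.
  rewrite msuppX inE => /(_ (eqxx _))[w Gw wv].
  have Iw : I 'X_[w] by apply/GI/mem_gen; exists w.
  have -> // : v = w.
  by apply: (lem_mdeg_eq wv); apply/eqP; rewrite eqn_leq (lem_mdeg wv) dv I_mdeg.
split=> [[G [GI Gmin] Gu]|Bu]; first by apply: (Gmin B) Gu => // v; apply: below GI.
exists B => //; split=> // G' _ G'I v; exact: below.
Qed.

Lemma mdeg3E u : mdeg u = 3%N -> exists x y z, u = (U_(x) + U_(y) + U_(z))%MM.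
Proof.
have pick k v : mdeg v = k.+1 -> exists x v', v = (v' + U_(x))%MM /\ mdeg v' = k.
  move=> dv; have [x _ /mnm_decr[v' dv']] : exists2 x, predT x & (0 < v x)%N.
    by apply: wt_gt0; rewrite wtT dv.
  by exists x, v'; split=> //; move: dv; rewrite dv' mdegD mdeg1; lia.
move=> /pick[z [u1 [-> /pick[y [u2 [-> /pick[x [u3 [-> /eqP]]]]]]]]].
by rewrite mdeg_eq0 => /eqP ->; exists x, y, z; rewrite add0m.
Qed.

Definition basis x y z : bool := prop_bool (I 'X_[U_(x) + U_(y) + U_(z)]).

Lemma basis_mingens x y z : basis x y z <-> mingens I (U_(x) + U_(y) + U_(z))%MM.
Proof.
split=> [/prop_boolP Ib|/mingensE[Ib _]]; last exact/prop_boolP.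
by apply/mingensE; rewrite !mdegD !mdeg1.
Qed.

Lemma basis_matroid : rank3_matroid basis.
Proof.
have C12 x y z : basis x y z = basis y x z by rewrite /basis [(U_(x) + U_(y))%MM]addmC.
have C23 x y z : basis x y z = basis x z y by rewrite /basis -!addmA [(U_(y) + _)%MM]addmC.
have xx x z : basis x x z = false.
  apply/negP => /basis_mingens/mingensE[Ib d3].
  by have := I_squarefree x Ib d3; rewrite !mnmDE !mnm1E eqxx.
have occ x a b c : (0 < (U_(a) + U_(b) + U_(c))%MM x)%N -> [\/ a = x, b = x | c = x].
  rewrite !mnmDE !mnm1E; case: eqP => [->|_]; first by constructor.
  case: eqP => [->|_]; first by constructor.
  by case: eqP => [->|_] //; constructor.
split=> // [x y z u v w b1 b2|x|x].
- set m := (U_(u) + U_(v) + U_(w))%MM.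
  (* If [x] occurs in the second basis, it is exchanged for itself; the polymatroidal exchange
     covers the other case. *)
  have [mx|mx] := posnP (m x); last first.
    by case: (occ _ _ _ _ mx) => ->; [constructor 1|constructor 2|constructor 3].
  have [[_ exch] _] := I_matroidal.
  have [|j jm Ij] := exch _ _ (proj1 (basis_mingens _ _ _) b1) (proj1 (basis_mingens _ _ _) b2) x.
    by rewrite -/m mx !mnmDE mnm1E eqxx.
  have bj : basis j y z.
    apply/prop_boolP; move: Ij; congr (I 'X_[_]).
    rewrite -[(U_(x) + U_(y) + U_(z))%MM]addmA [(U_(x) + _)%MM]addmC addmK.
    by rewrite addmC addmA.
  have mj : (0 < m j)%N by apply: leq_ltn_trans jm.
  by case: (occ _ _ _ _ mj) => jE; move: bj; rewrite -jE;
    [constructor 1|constructor 2|constructor 3].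
- have [u gu ux] := I_full x; have [u' def_u] := mnm_decr ux.
  have [_ du] := proj1 (mingensE u) gu.
  have [a [b [c def_u2]]] := mdeg3E du.
  move: gu ux; rewrite def_u2 => /basis_mingens b0 /occ[] e; rewrite -e.
  + by exists b, c.
  + by exists a, c; rewrite C12.
  + by exists a, b; rewrite C12 C23.
(* A coloop would divide every generator, hence the gcd. *)
- apply: NNPP => no_b; have [_ /(_ U_(x)%MM) gcdx] := I_gcd.
  suff : (U_(x) <= 0)%MM by move=> /mnm_lepP/(_ x); rewrite mnm1E eqxx mnm0E.
  apply: gcdx => u gu; have [_ du] := proj1 (mingensE u) gu.
  have [a [b [c def_u]]] := mdeg3E du; have := gu; rewrite def_u => /basis_mingens b0.
  apply/mnm_lepP => i; rewrite mnm1E; case: eqP => // <-; rewrite lt0n.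
  apply/negP => /eqP; rewrite !mnmDE !mnm1E => eq0; apply: no_b; exists a, b, c.
  by split=> //; apply/negP => /eqP e; move: eq0; rewrite e eqxx; lia.
Qed.

Lemma I_cond1 : I = pow_nm basis 1.
Proof.
have [[[G GI _] _] _] := I_matroidal.
have idI : is_ideal I.
  have -> : I = mon_ideal G by apply: pred_ext.
  exact: gen_ideal_ideal.
have M := basis_matroid; have [_ _ IM] := idI.
have sub x y z m : basis x y z -> I 'X_[m + (U_(x) + U_(y) + U_(z))].
  by move=> /prop_boolP b; rewrite mpolyXD; apply: IM.
have E m : I 'X_[m] <-> cond basis 1 m.
  split=> [/I_gen[u [Iu du um]]|/(cond1_basis M)[x [y [z [m' [b ->]]]]]]; last exact: sub.
  have [x [y [z def_u]]] := mdeg3E du.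
  rewrite -(submK um) addmC; apply/upc_cond; rewrite def_u; apply: (cond_basis M).
  by apply/prop_boolP; rewrite -def_u.
apply: pred_ext => f; apply: iff_trans (I_supp f) _.
by split=> h m /h /E.
Qed.

Lemma pow_idealE t : pow_ideal I t = pow_nm basis t.
Proof.
have M := basis_matroid; elim: t => [|t IHt].
  apply: pred_ext => f; split=> // _ m _.
  by apply/condP; split=> *; rewrite ?muln0.
rewrite /= IHt I_cond1; apply: pred_ext => f; split.
  apply: gen_ideal_min => [|_ [g [h [Cg Ch ->]]] m]; first exact: pow_nm_ideal.
  case/msuppM_le/allpairsP => -[m1 m2] /= [/Cg c1 /Ch c2 ->].
  by rewrite -add1n; apply: condD.
apply: ideal_nm_min => [|m]; first exact: gen_ideal_ideal.
case/(cond_split M) => x [y [z [m' [b -> c']]]]; rewrite mpolyXD mulrC; apply: mem_gen.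
by exists 'X_[U_(x) + U_(y) + U_(z)], 'X_[m']; split=> //; apply/nmX => //; apply: cond_basis.
Qed.

End Bases.

(** * Stability indices *)

Section Stability.

Local Open Scope ring_scope.

Variables (K : fieldType) (n : nat) (bs : 'I_n -> 'I_n -> 'I_n -> bool).
Hypothesis M : rank3_matroid bs.
Local Notation R := {mpoly K[n]}.
Local Notation npar := (npar bs).
Local Notation par := (par bs).
Local Notation pow_nm := (@pow_nm K n bs).
Implicit Types (V W : pred 'I_n) (t s : nat) (P : R -> Prop) (x y q : 'I_n).

Definition is_pv P V := forall g, P g <-> nm (pv V) g.

Lemma is_pv_inj P V W : is_pv P V -> is_pv P W -> V =1 W.
Proof.
move=> PV PW i; have : nm (pv V) ('X_i : R) <-> nm (pv W) ('X_i : R).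
  exact: iff_trans (iff_sym (PV _)) (PW _).
rewrite !nmX /pv !wtU; case: (V i) (W i) => [] [] // [h1 h2]; first by have := h1 isT.
by have := h2 isT.
Qed.

Lemma is_pv_ext P V W : V =1 W -> is_pv P V -> is_pv P W.
Proof.
move=> VW PV g; apply: iff_trans (PV g) _; apply: nm_ext => m.
by rewrite /pv (wt_ext _ VW).
Qed.

Lemma Ass_pow (x0 : 'I_n) t P : (0 < t)%N -> Ass (pow_nm t) P <->
  [\/ exists x y, npar x y /\ is_pv P (bs x y),
      (1 < t)%N /\ (exists x, three_lines bs x /\ is_pv P (npar x)) | socle bs t /\ is_pv P predT].
Proof.
move=> t0; apply: iff_trans (Ass_nm P (@upc_cond n bs t) (@saturated_cond n bs t)) _.
split=> [[V [u [wit PV]]]|].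
  have [[x [y [nxy e]]]|[t1 [x [tx e]]]|e] := wit_class M t0 wit.
  - by constructor 1; exists x, y; split=> //; apply: is_pv_ext e PV.
  - by constructor 2; split=> //; exists x; split=> //; apply: is_pv_ext e PV.
  - constructor 3; split; last exact: is_pv_ext e PV.
    apply/(socle_witness M x0); exists u; case: wit => nC CV big; split=> // i.
    by move=> _; apply: CV; rewrite e.
case=> [[x [y [nxy PV]]]|[t1 [x [tx PV]]]|[/(socle_witness M x0)[u wit] PV]].
- by have [u wit] := wit_line M t0 nxy; exists (bs x y), u.
- by have [u wit] := wit_point M t1 tx; exists (npar x), u.
- by exists predT, u.
Qed.

Definition pow_astab := least_stable (fun t s => forall P, Ass (pow_nm t) P <-> Ass (pow_nm s) P).

Definition pow_dstab := least_stable (fun t s =>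
  exists2 d, is_depth (pow_nm t) d & is_depth (pow_nm s) d).

(** For [n = 0] the matroid axioms hold vacuously, and every positive power is the zero ideal of a
    field. *)
Lemma no_variable_stab : (forall x : 'I_n, False) -> pow_astab 1 /\ pow_dstab 1.
Proof.
move=> no_x; have same t : (0 < t)%N -> pow_nm t = pow_nm 1.
  have m0 (m : 'X_{1..n}) : mdeg m = 0%N by rewrite mdegE big1 // => x; case: (no_x x).
  move=> t0; apply: eq_nm => m; apply/condP/condP => -[]; rewrite m0; lia.
have d0 : is_depth (pow_nm 1) 0.
  apply: (@socle_depth0 _ _ _ 0%MM); [exact: upc_cond | exact: cond_0|].
  by move=> x; case: (no_x x).
split; split=> [|s [s0 st]//]; split=> // t t1; rewrite same //.
by exists 0%N.
Qed.

Lemma socle_stab (x0 : 'I_n) : (exists t, socle bs t) -> exists2 s, pow_astab s & pow_dstab s.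
Proof.
move=> exS; have exb : exists t, prop_bool (socle bs t).
  by have [t st] := exS; exists t; apply/prop_boolP.
have [s /prop_boolP ss min_s] := ex_minnP exb.
have s2 := socle_ge2 M ss.
have below s' : (0 < s')%N -> (s' < s)%N -> ~ socle bs s'.
  by move=> _ lt_s /prop_boolP/min_s; rewrite leqNgt lt_s.
exists s; split.
- split=> [|t le_st P]; first exact: ltnW.
  have t2 := leq_trans s2 le_st; have st := socle_leq M x0 le_st ss.
  by rewrite !(Ass_pow x0) ?(ltnW t2) ?(ltnW s2) //; split=> -[h|[_ h]|[_ h]];
    by [constructor 1|constructor 2|constructor 3].
(* Stability before [s] would make the maximal ideal associated too early; the primes of points and
   lines differ from it because a flat contains its own points. *)
- move=> s' [s'0 st']; rewrite leqNgt; apply/negP => lt_s.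
  have /(st' s (ltnW lt_s))/(Ass_pow x0 _ s'0) : Ass (pow_nm s) (nm (pv predT)).
    by apply/(Ass_pow x0) => //; [exact: ltnW | constructor 3].
  case=> [[x [y [_ /is_pv_inj/(_ (fun g => iff_refl _))/(_ x)]]]
         |[_ [x [_ /is_pv_inj/(_ (fun g => iff_refl _))/(_ x)]]]|[/(below _ s'0 lt_s)//]].
    by rewrite (negPf (linxyx M _ _)).
  by rewrite (nparxx M).
- split=> [|t le_st]; first exact: ltnW.
  have st := socle_leq M x0 le_st ss.
  by exists 0%N; [apply: (pow_depth0 K M x0 st) | apply: (pow_depth0 K M x0 ss)].
- move=> s' [s'0 st']; rewrite leqNgt; apply/negP => lt_s.
  have [d ds ds'] := st' s (ltnW lt_s); have d0 := depth_uniq ds (pow_depth0 K M x0 ss).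
  by apply: (not_depth0 M x0 s'0 (below _ s'0 lt_s)); rewrite d0 in ds'; exact: ds'.
Qed.

Lemma pencil_stab q : pencil bs q -> exists2 s, pow_astab s & pow_dstab s.
Proof.
move=> Hq; have ns := pencil_not_socle M Hq; have [tq|ntq] := classic (three_lines bs q).
  exists 2%N; split.
  - split=> // t t2 P; rewrite !(Ass_pow q) ?(ltnW t2) //.
    by split=> -[h|[_ h]|[/ns//]]; by [constructor 1|constructor 2].
  - move=> [|[|s]] [] // _ st; have /(st 2%N isT)/(Ass_pow q _ (isT : 0 < 1)%N) :
      Ass (pow_nm 2) (nm (pv (npar q))).
      by apply/(Ass_pow q) => //; constructor 2; split=> //; exists q.
    case=> [[x [y [nxy /is_pv_inj/(_ (fun g => iff_refl _)) e]]]|[]//|[/ns//]].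
    (* The prime of the point [q] is not that of a line: equality would make both [x] and [y]
       parallel to [q], hence to each other. *)
    have px : par q x by rewrite -nparN -e; apply: linxyx.
    have py : npar q y = false by rewrite -e; apply/negbTE/linxyy.
    by rewrite -(npar_par M _ px) py in nxy.
  - split=> // t t2; exists 1%N; apply: (pencil_depth1 _ M Hq) => //.
  - move=> [|[|s]] [] // _ st; have [d d2 d1] := st 2%N isT.
    have dE := depth_uniq d2 (pencil_depth1 K M Hq (isT : 1 < 2)%N tq); subst d.
    have [|s' ss [ms reg]] := pencil_two_seq K M Hq (isT : 0 < 1)%N; first by left.
    by have [_ /(_ s' ms reg)] := d1; rewrite ss.
exists 1%N; split=> [|s [s0 st]//]; split=> // t t1.
  move=> P; rewrite !(Ass_pow q) //.
  have n3 x := pencil_no_three M Hq (x := x) ntq.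
  by split=> -[h|[_ [x [/n3//]]]|[/ns//]]; constructor 1.
by exists 2%N; apply: (pencil_depth2 K M Hq).
Qed.

Lemma matroid_stab : exists2 s, pow_astab s & pow_dstab s.
Proof.
have [[x0 _]|no_x] := classic (exists x : 'I_n, True); last first.
  by have [|h1 h2] := no_variable_stab; [move=> x; apply: no_x; exists x | exists 1%N].
have [[x [y [z [w [b1 b2 b3 b4]]]]]|[q Hq]] := general_or_pencil M x0; last exact: pencil_stab Hq.
by apply: (socle_stab x0); exists 3%N; apply: socle_general b1 b2 b3 b4.
Qed.

End Stability.

Theorem corollary2p13 (K : fieldType) (n : nat) (I : {mpoly K[n]} -> Prop)
    (I_matroidal : matroidal I 3)
    (I_full : full_supported I)
    (I_gcd : is_gcd 0%MM (mingens I)) :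
  exists2 s : nat, is_astab I s & is_dstab I s.
Proof.
have [s astab_s dstab_s] := matroid_stab K (basis_matroid I_matroidal I_full I_gcd).
have powE : pow_ideal I = pow_nm (basis I).
  by apply: functional_extensionality => t; apply: pow_idealE.
by exists s; rewrite /is_astab /is_dstab powE.
Qed.
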